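(* Let $X$ be a set and let $F=F_X$ be the free group on the basis $X$, with lower central filtration $F^{(n,0)}$. For every $n\ge2$, the $\mathbb{Z}$-module $H^2(F/F^{(n,0)},\mathbb{Z})_{n\text{-Massey}}$ is free of rank $l_{|X|}(n)$.
   Context: The lower central filtration is $F^{(1,0)}=F$, $F^{(n+1,0)}=[F^{(n,0)},F]$. For a positive integer $m$ the necklace function is $l_m(n)=\frac1n\sum_{d\mid n}\mu(d)m^{n/d}$, where $\mu$ is the Möbius function, with the convention $l_\infty(n)=\infty$ (so for infinite $X$ the rank is infinite). Cohomology is group cohomology with trivial action on $\mathbb{Z}$, computed by inhomogeneous cochains; $\partial$ is the differential. $\mathbb{Z}\langle\langle X\rangle\rangle=\prod_{n\ge0}\mathbb{Z}\langle X\rangle^{(n)}$, where $\mathbb{Z}\langle X\rangle^{(n)}$ is the degree $n$ component of the free associative algebra on $X$; the Magnus homomorphism $\mu_{\mathbb{Z}}\colon F\to\mathbb{Z}\langle\langle X\rangle\rangle^\times$ is given by $\mu_{\mathbb{Z}}(x)=1+x$ for $x\in X$; write $\mu_{\mathbb{Z}}(g)=\sum_{w\in X^*}\mu_{\mathbb{Z},w}(g)w$, where $X^*$ is the set of finite words in the alphabet $X$ and $|w|$ is the length of $w$. Every coefficient function $\mu_{\mathbb{Z},u}$ with $1\le|u|\le n-1$ factors through $F/F^{(n,0)}$. For $n\ge 2$ and a word $w=(x_1\cdots x_n)$ of length $n$, define 1-cochains $\bar c_{ij}\in C^1(F/F^{(n,0)},\mathbb{Z})$ for $1\le i<j\le n+1$,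 $(i,j)\ne(1,n+1)$, by $\bar c_{ij}(gF^{(n,0)})=(-1)^{j-i}\mu_{\mathbb{Z},(x_i\cdots x_{j-1})}(g)$. They form a defining system for an $n$-fold Massey product, i.e. $\partial\bar c_{ij}=-\sum_{k=i+1}^{j-1}\bar c_{ik}\cup\bar c_{kj}$, and $\sum_{k=2}^n\bar c_{1k}\cup\bar c_{k,n+1}$ is a 2-cocycle; let $\psi_w\in H^2(F/F^{(n,0)},\mathbb{Z})$ be its class (the value of the defining system, an element of the Massey product $\langle[\bar c_{12}],\ldots,[\bar c_{n,n+1}]\rangle$). Then $H^2(F/F^{(n,0)},\mathbb{Z})_{n\text{-Massey}}$ is the subgroup of $H^2(F/F^{(n,0)},\mathbb{Z})$ generated by all $\psi_w$, $w\in X^*$, $|w|=n$. *)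

(* Defs.v *)
From HB Require Import structures.
From mathcomp Require Import all_boot all_order all_algebra.
From mathcomp Require Import finmap all_classical.
From mathcomp Require Import zify ring.

Set Implicit Arguments.
Unset Strict Implicit.
Unset Printing Implicit Defensive.

Import Order.TTheory GRing.Theory Num.Theory.

Local Open Scope classical_set_scope.
Local Open Scope ring_scope.

(* The pair (x, true) is the letter x, and (x, false) is the letter x^-1;
   elements of the free group are the reduced words in these letters. *)
Section FreeGroup.
Variable X : choiceType.

Definition letter := (X * bool)%type.

Definition inv_letter (a : letter) : letter := (a.1, ~~ a.2).

Definition reduced (w : seq letter) : bool :=
  sorted (fun a b => b != inv_letter a) w.

Record freegroup := FreeGroup { fg_word : seq letter; _ : reduced fg_word }.

HB.instance Definition _ := [isSub for fg_word].
HB.instance Definition _ := [Choice of freegroup by <:].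

Definition push (a : letter) (w : seq letter) : seq letter :=
  if w is b :: w' then if b == inv_letter a then w' else a :: w else [:: a].

Lemma inv_letterK : involutive inv_letter.
Proof. by case=> x b; rewrite /inv_letter negbK. Qed.

Lemma inv_letter_neq a b : (b != inv_letter a) = (a != inv_letter b).
Proof.
apply/negb_inj; rewrite !negbK; apply/eqP/eqP => ->; by rewrite inv_letterK.
Qed.

Lemma reduced_tail a w : reduced (a :: w) -> reduced w.
Proof. exact: path_sorted. Qed.

Lemma push_reduced a w : reduced w -> reduced (push a w).
Proof.
case: w => [//|b w] rw /=; case: ifP => [_|/negbT ba]; first exact: reduced_tail rw.
by rewrite /reduced /= ba.
Qed.

Lemma foldr_push_reduced u v : reduced v -> reduced (foldr push v u).
Proof. by move=> rv; elim: u => //= a u; apply: push_reduced. Qed.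

Lemma pushK a w : reduced w -> push (inv_letter a) (push a w) = w.
Proof.
case: w => [|b w] rw /=; first by rewrite inv_letterK eqxx.
case: ifP => [/eqP ba|ba] /=; last by rewrite inv_letterK eqxx.
case: w rw => [|c w] /=; first by rewrite ba.
rewrite /reduced /= => /andP[cb _].
by rewrite -ba (negbTE cb).
Qed.

Lemma foldr_push_push a v w : reduced w -> reduced v ->
  foldr push w (push a v) = push a (foldr push w v).
Proof.
move=> rw; case: v => [//|b v] rv /=; case: ifP => [/eqP ->|//].
by rewrite -{1}[a]inv_letterK pushK // foldr_push_reduced.
Qed.

Lemma foldr_push_nil u : reduced u -> foldr push [::] u = u.
Proof.
elim: u => //= a u IH ru; rewrite IH; last exact: reduced_tail ru.
case: u ru {IH} => //= b u /andP[ba _]; by rewrite (negbTE ba).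
Qed.

Definition fg_one : freegroup := @FreeGroup [::] isT.

Definition fg_mul (u v : freegroup) : freegroup :=
  FreeGroup (foldr_push_reduced (fg_word u) (valP v)).

Definition inv_word (u : seq letter) := rev (map inv_letter u).

Lemma inv_word_reduced u : reduced u -> reduced (inv_word u).
Proof.
rewrite /reduced /inv_word rev_sorted; case: u => //= a u.
elim: u a => //= b u IH a /andP[ba bu]; rewrite IH // andbT.
by rewrite inv_letterK eq_sym.
Qed.

Definition fg_inv (u : freegroup) : freegroup :=
  FreeGroup (inv_word_reduced (valP u)).

Lemma fg_mulA : associative fg_mul.
Proof.
move=> u v w; apply: val_inj => /=.
elim: (fg_word u) => //= a s ->; rewrite foldr_push_push ?(valP w) //.
exact: foldr_push_reduced (valP v).
Qed.

Lemma fg_mul1 : left_id fg_one fg_mul.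
Proof. by move=> u; apply: val_inj. Qed.

Lemma fg_mul_1 : right_id fg_one fg_mul.
Proof. by move=> u; apply: val_inj; rewrite /= foldr_push_nil ?(valP u). Qed.

Lemma fg_mulV : left_inverse fg_one fg_inv fg_mul.
Proof.
case=> u ru; apply: val_inj => /=; rewrite /inv_word.
elim: u {ru} => //= a u IH; rewrite rev_cons foldr_rcons /=.
by rewrite inv_letterK eqxx.
Qed.

Lemma fg_invK : involutive fg_inv.
Proof.
case=> u ru; apply: val_inj; rewrite /= /inv_word map_rev revK -map_comp.
by rewrite map_id_in // => a _ /=; rewrite inv_letterK.
Qed.

Lemma fg_mulV' : right_inverse fg_one fg_inv fg_mul.
Proof. by move=> u; rewrite -{1}[u]fg_invK fg_mulV. Qed.

HB.instance Definition _ :=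
  isGroup.Build freegroup fg_mulA fg_mul1 fg_mul_1 fg_mulV fg_mulV'.

Definition fg_gen (x : X) : freegroup := @FreeGroup [:: (x, true)] isT.

End FreeGroup.

Section Subgroups.
Variable G : groupType.

Definition is_subgroup (H : set G) : Prop :=
  [/\ H 1%g, forall x y, H x -> H y -> H (x * y)%g & forall x, H x -> H x^-1%g].

Definition gen_subgroup (S : set G) : set G :=
  [set x | forall H : set G, is_subgroup H -> S `<=` H -> H x].

Definition commutator_subgroup (A B : set G) : set G :=
  gen_subgroup [set z | exists a b, [/\ A a, B b & z = [~ a, b]%g]].

(* lcs n is the n-th term of the filtration for n >= 1, starting at
   lcs 1 = G; the value at n = 0 is a dummy. *)
Fixpoint lcs (n : nat) : set G :=
  match n with
  | 0 | 1 => setT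
  | m.+1 => commutator_subgroup (lcs m) setT
  end.

Record normal_subgroup := NormalSubgroup {
  normal_set : set G;
  normal_is_subgroup : is_subgroup normal_set;
  normal_conj : forall x y, normal_set x -> normal_set (x ^ y)%g }.

Lemma gen_subgroup_is_subgroup S : is_subgroup (gen_subgroup S).
Proof.
split=> [H [] //|x y Sx Sy H sH SH|x Sx H sH SH].
  by have [_ HM _] := sH; apply: HM; [apply: Sx|apply: Sy].
by have [_ _ HV] := sH; apply: HV; apply: Sx.
Qed.

Lemma lcs_subgroup n : is_subgroup (lcs n).
Proof.
by case: n => [|[|n]]; [split|split|apply: gen_subgroup_is_subgroup].
Qed.

Lemma lcs_conj n x y : lcs n x -> lcs n (x ^ y)%g.
Proof.
elim: n x y => [//|[//|n] IH] x y; rewrite /= -/(lcs n.+1).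
move=> lx H sH SH; have [H1 HM HV] := sH.
have sK : is_subgroup [set z | H (z ^ y)%g].
  split=> /= [|u v Hu Hv|u Hu]; first by rewrite conj1g.
    by rewrite conjMg; apply: HM.
  by rewrite conjVg; apply: HV.
apply: (lx _ sK) => _ [a [b [Aa _ ->]]] /=; apply: SH.
by exists (a ^ y)%g, (b ^ y)%g; split => //; [apply: IH|rewrite conjRg].
Qed.

Definition lcs_normal n : normal_subgroup :=
  NormalSubgroup (lcs_subgroup n) (@lcs_conj n).

End Subgroups.

Section QuotientGroup.
Variables (G : groupType) (N : normal_subgroup G).
Local Open Scope quotient_scope.

Definition coset_rel (x y : G) : bool := `[< normal_set N (x^-1 * y)%g >].

Lemma coset_rel_equiv : equiv_class_of coset_rel.
Proof.
have [N1 NM NV] := normal_is_subgroup N.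
split=> [x|x y|y x z]; rewrite /coset_rel.
- by apply/asboolP; rewrite mulVg.
- by apply/asboolP/asboolP => /NV; rewrite invgM invgK.
- move=> /asboolP xy /asboolP yz; apply/asboolP.
  by have := NM _ _ xy yz; rewrite -mulgA mulVKg.
Qed.

Canonical coset_equiv := EquivRelPack coset_rel_equiv.
Canonical coset_encModRel := defaultEncModRel coset_rel.

Definition quotient_group := {eq_quot coset_rel}.

HB.instance Definition _ := EqQuotient.on quotient_group.
HB.instance Definition _ := Choice.on quotient_group.

Definition proj (x : G) : quotient_group := \pi_quotient_group x.

Lemma proj_eq x y : proj x = proj y <-> normal_set N (x^-1 * y)%g.
Proof.
split=> [/eqP|Nxy]; first by rewrite /proj eqmodE => /asboolP.
by apply/eqP; rewrite /proj eqmodE; apply/asboolP.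
Qed.

Lemma reprP (q : quotient_group) : proj (repr q) = q.
Proof. exact: reprK. Qed.

Definition qmul (a b : quotient_group) := proj (repr a * repr b)%g.
Definition qinv (a : quotient_group) := proj (repr a)^-1%g.

Lemma qmulE x y : qmul (proj x) (proj y) = proj (x * y)%g.
Proof.
have [N1 NM NV] := normal_is_subgroup N.
have /proj_eq Nx := reprP (proj x); have /proj_eq Ny := reprP (proj y).
rewrite /qmul; move: (repr (proj x)) (repr (proj y)) Nx Ny => x' y' Nx Ny.
apply/proj_eq.
have -> : ((x' * y')^-1 * (x * y))%g = ((x'^-1 * x) ^ y' * (y'^-1 * y))%g.
  by rewrite conjgE invgM !mulgA mulgK.
by apply: NM => //; apply: normal_conj.
Qed.

Lemma qinvE x : qinv (proj x) = proj x^-1%g.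
Proof.
have [N1 NM NV] := normal_is_subgroup N.
have /proj_eq Nx := reprP (proj x).
rewrite /qinv; move: (repr (proj x)) Nx => x' /NV Nx.
apply/proj_eq; have := @normal_conj _ N _ x'^-1%g Nx.
by rewrite conjgE !invgM !invgK !mulgA mulgK.
Qed.

Lemma qmulA : associative qmul.
Proof.
move=> a b c; rewrite -[a]reprP -[b]reprP -[c]reprP.
by rewrite !qmulE mulgA.
Qed.

Lemma qmul1 : left_id (proj 1%g) qmul.
Proof. by move=> a; rewrite -[a]reprP qmulE mul1g. Qed.

Lemma qmul_1 : right_id (proj 1%g) qmul.
Proof. by move=> a; rewrite -[a]reprP qmulE mulg1. Qed.

Lemma qmulV : left_inverse (proj 1%g) qinv qmul.
Proof. by move=> a; rewrite -[a]reprP qinvE qmulE mulVg. Qed.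

Lemma qmulV' : right_inverse (proj 1%g) qinv qmul.
Proof. by move=> a; rewrite -[a]reprP qinvE qmulE mulgV. Qed.

HB.instance Definition _ :=
  isGroup.Build quotient_group qmulA qmul1 qmul_1 qmulV qmulV'.

Lemma projM x y : proj (x * y)%g = (proj x * proj y)%g.
Proof. by rewrite -qmulE. Qed.

End QuotientGroup.

(* Arbitrary functions from words to integers, with the Cauchy product. *)
Section WordFunctions.
Variable X : choiceType.

Definition wordfun := seq X -> int.

HB.instance Definition _ := GRing.Zmodule.copy wordfun (seq X -> int).

Definition wf_one : wordfun := fun w => (w == [::])%:R.

Definition wf_mul (f g : wordfun) : wordfun :=
  fun w => \sum_(i < (size w).+1) f (take i w) * g (drop i w).

Lemma wf_mul_nil f g : wf_mul f g [::] = f [::] * g [::].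
Proof. by rewrite /wf_mul big_ord1. Qed.

Lemma wf_mul_cons f g x w : wf_mul f g (x :: w) =
  f [::] * g (x :: w) + wf_mul (fun v => f (x :: v)) g w.
Proof. by rewrite /wf_mul big_ord_recl. Qed.

Lemma wf_addE (f g : wordfun) w : (f + g) w = f w + g w.
Proof. by []. Qed.

Lemma wf_mulDl : left_distributive wf_mul +%R.
Proof.
move=> f g h; apply/funext => w; rewrite wf_addE /wf_mul -big_split /=.
by apply: eq_bigr => i _; rewrite wf_addE mulrDl.
Qed.

Lemma wf_mulDr : right_distributive wf_mul +%R.
Proof.
move=> f g h; apply/funext => w; rewrite wf_addE /wf_mul -big_split /=.
by apply: eq_bigr => i _; rewrite wf_addE mulrDr.
Qed.

Lemma wf_mulZ c f g w : wf_mul (fun v => c * f v) g w = c * wf_mul f g w.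
Proof. by rewrite /wf_mul mulr_sumr; apply: eq_bigr => i _; rewrite mulrA. Qed.

Lemma wf_mul1 : left_id wf_one wf_mul.
Proof.
move=> f; apply/funext => w; rewrite /wf_mul big_ord_recl take0 drop0 mul1r.
rewrite big1 ?addr0 // => i _; rewrite /wf_one.
by case: w i => [[]//|x w i] /=; rewrite mul0r.
Qed.

Lemma wf_mul_1 : right_id wf_one wf_mul.
Proof.
move=> f; apply/funext => w; rewrite /wf_mul big_ord_recr /= take_size drop_size mulr1.
rewrite big1 ?add0r // => i _; rewrite /wf_one -size_eq0 size_drop subn_eq0.
by rewrite leqNgt ltn_ord mulr0.
Qed.

Lemma wf_mulA : associative wf_mul.
Proof.
move=> f g h; apply/funext => w; elim: w f => [|x w IH] f.
  by rewrite !wf_mul_nil mulrA.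
rewrite !wf_mul_cons wf_mul_nil IH mulrDr -!addrA mulrA; congr (_ + _).
have -> : (fun v => wf_mul f g (x :: v)) =
    (fun v => f [::] * g (x :: v)) + wf_mul (fun v => f (x :: v)) g :> wordfun.
  by apply/funext => v; rewrite wf_mul_cons.
by rewrite wf_mulDl wf_addE wf_mulZ.
Qed.

Lemma wf_one_neq0 : wf_one != 0.
Proof. by apply/eqP => /(congr1 (fun f => f [::])). Qed.

HB.instance Definition _ := GRing.Zmodule_isNzRing.Build wordfun
  wf_mulA wf_mul1 wf_mul_1 wf_mulDl wf_mulDr wf_one_neq0.

(* Finitely many nonzero coefficients in each degree: these functions form
   the product over n >= 0 of the degree n components of the free associative
   algebra, also when X is infinite. *)
Definition degreewise_finite : {pred wordfun} := fun f =>
  `[< forall n, finite_set [set w : seq X | size w = n /\ f w <> 0] >].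

Lemma degreewise_finite_subring : subring_closed degreewise_finite.
Proof.
split.
- apply/asboolP => n; apply: (@sub_finite_set _ _ [set [::]]) => // w [_].
  by case: w.
- move=> f g /asboolP ff /asboolP fg; apply/asboolP => n.
  apply: (@sub_finite_set _ _ ([set w | size w = n /\ f w <> 0] `|`
     [set w | size w = n /\ g w <> 0])); last by rewrite finite_setU.
  move=> w [sw] /= fgw; have [f0|/eqP f0] := eqVneq (f w) 0; last by left.
  right; split=> // g0; apply: fgw.
  by rewrite -[LHS]/(f w - g w) f0 g0 subrr.
- move=> f g /asboolP ff /asboolP fg; apply/asboolP => n.
  pose A i := [set w : seq X | size w = i /\ f w <> 0].
  pose B i := [set w : seq X | size w = i /\ g w <> 0].
  apply: (@sub_finite_set _ _
     (\bigcup_(i in `I_n.+1) ((fun p => p.1 ++ p.2) @` (A i `*` B (n - i)%N)))).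
    move=> w [sw] /= fgw; apply: contrapT => nw; apply: fgw.
    rewrite -[LHS]/(wf_mul f g w) /wf_mul big1 // => i _; apply/eqP.
    rewrite mulf_eq0; have [//|/eqP f0] := eqVneq (f _) 0.
    apply/eqP; apply: contrapT => g0; apply: nw.
    have iw : (i <= size w)%N by rewrite -ltnS.
    exists i; first by rewrite /= -sw.
    exists (take i w, drop i w); last by rewrite /= cat_take_drop.
    have si : size (take i w) = i by rewrite size_take_min; apply/minn_idPl.
    by split; split => //=; rewrite size_drop -sw.
  apply: bigcup_finite => // i _; apply: finite_image.
  by apply: finite_setX; [apply: ff|apply: fg].
Qed.

HB.instance Definition _ :=
  GRing.isSubringClosed.Build wordfun degreewise_finite degreewise_finite_subring.

End WordFunctions.

Section MagnusAlgebra.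
Variable X : choiceType.

Record ncseries := NCSeries { coefs : wordfun X; _ : coefs \in @degreewise_finite X }.

HB.instance Definition _ := [isSub for coefs].
HB.instance Definition _ := [Choice of ncseries by <:].
HB.instance Definition _ := [SubChoice_isSubNzRing of ncseries by <:].

Definition nccoef (f : ncseries) (w : seq X) : int := coefs f w.
Arguments nccoef : simpl never.

Lemma ncseriesP (f g : ncseries) : nccoef f =1 nccoef g -> f = g.
Proof. by move=> fg; apply: val_inj; apply/funext. Qed.

Lemma nccoefD (f g : ncseries) w : nccoef (f + g) w = nccoef f w + nccoef g w.
Proof. by []. Qed.

Lemma nccoefN (f : ncseries) w : nccoef (- f) w = - nccoef f w.
Proof. by []. Qed.

Lemma nccoefB (f g : ncseries) w : nccoef (f - g) w = nccoef f w - nccoef g w.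
Proof. by []. Qed.

Lemma nccoef1 w : nccoef 1 w = (w == [::])%:R.
Proof. by []. Qed.

Lemma nccoefM (f g : ncseries) w :
  nccoef (f * g) w = \sum_(i < (size w).+1) nccoef f (take i w) * nccoef g (drop i w).
Proof. by []. Qed.

Lemma finite_degreewise (f : wordfun X) :
  (forall n, finite_set [set w : seq X | size w = n /\ f w <> 0]) ->
  f \in @degreewise_finite X.
Proof. by move=> ?; apply/asboolP. Qed.

Definition ncX_fun (x : X) : wordfun X := fun w => (w == [:: x])%:R.

Lemma ncX_finite x : ncX_fun x \in @degreewise_finite X.
Proof.
apply: finite_degreewise => n; apply: (@sub_finite_set _ _ [set [:: x]]) => //.
by move=> w [_]; rewrite /ncX_fun; case: eqP.
Qed.

Definition ncX (x : X) : ncseries := NCSeries (ncX_finite x).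

(* \sum_(k >= 0) (- x)^k, the inverse of 1 + x *)
Definition inv1X_fun (x : X) : wordfun X :=
  fun w => if all (pred1 x) w then (-1) ^+ size w else 0.

Lemma inv1X_finite x : inv1X_fun x \in @degreewise_finite X.
Proof.
apply: finite_degreewise => n; apply: (@sub_finite_set _ _ [set nseq n x]) => //.
by move=> w [<-]; rewrite /inv1X_fun; case: ifP => // /all_pred1P.
Qed.

Definition inv1X (x : X) : ncseries := NCSeries (inv1X_finite x).

Lemma nccoef_ncXM x (f : ncseries) w :
  nccoef (ncX x * f) w = if w is y :: w' then (y == x)%:R * nccoef f w' else 0.
Proof.
rewrite nccoefM; case: w => [|y w]; first by rewrite big_ord1 /= mul0r.
rewrite big_ord_recl /= mul0r add0r big_ord_recl /= take0 drop0 big1 ?addr0.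
  by rewrite /nccoef /= /ncX_fun eqseq_cons eqxx andbT.
move=> i _; case: w i => [[]//|z w i] /=.
by rewrite /nccoef /= /ncX_fun !eqseq_cons andbF mul0r.
Qed.

Lemma nccoef_MncX x (f : ncseries) w :
  nccoef (f * ncX x) w = if w is [::] then 0 else
    (last x w == x)%:R * nccoef f (take (size w).-1 w).
Proof.
rewrite nccoefM; case: (lastP w) => [|v y]; first by rewrite big_ord1 /= mulr0.
have -> T (a b : T) : (if rcons v y is [::] then a else b) = b by case: v.
rewrite size_rcons big_ord_recr big_ord_recr /= last_rcons big1 ?add0r.
  rewrite -cats1 drop_size_cat // take_size_cat // drop_oversize ?size_cat ?addn1 //.
  by rewrite /nccoef /= /ncX_fun eqseq_cons eqxx andbT mulr0 addr0 mulrC.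
move=> i _; rewrite /nccoef /= /ncX_fun.
case: eqP => [/(congr1 size)|_]; last by rewrite mulr0.
rewrite size_drop size_rcons subSn ?(ltnW (ltn_ord i)) //= => -[] /eqP.
by rewrite subn_eq0 leqNgt ltn_ord.
Qed.

Lemma mul1X_inv x : (1 + ncX x) * inv1X x = 1.
Proof.
apply: ncseriesP => w; rewrite mulrDl mul1r nccoefD nccoef_ncXM.
case: w => [|y w]; first by rewrite addr0.
rewrite (nccoef1 (y :: w)) /nccoef /= /inv1X_fun /=; case: eqP => _ /=; last by rewrite mul0r addr0.
by case: ifP => _; rewrite mul1r ?exprS ?mulN1r ?addNr ?addr0.
Qed.

Lemma mul_inv1X x : inv1X x * (1 + ncX x) = 1.
Proof.
apply: ncseriesP => w; rewrite mulrDr mulr1 nccoefD nccoef_MncX.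
case: (lastP w) => [|v y]; first by rewrite addr0.
have -> T (a b : T) : (if rcons v y is [::] then a else b) = b by case: v.
rewrite last_rcons size_rcons /= -cats1 take_size_cat // nccoef1.
rewrite /nccoef /= /inv1X_fun all_cat /= andbT size_cat addn1.
have -> : (v ++ [:: y] == [::]) = false by case: v.
case: (y == x) => /=; last by rewrite andbF mul0r addr0.
by rewrite andbT; case: ifP => _; rewrite mul1r ?exprS ?mulN1r ?addNr ?addr0.
Qed.

End MagnusAlgebra.

Section Magnus.
Variable X : choiceType.
Implicit Types (g h : freegroup X) (f : ncseries X).

Definition magnus_letter (a : letter X) : ncseries X :=
  if a.2 then 1 + ncX a.1 else inv1X a.1.

Definition magnus g : ncseries X := \prod_(a <- fg_word g) magnus_letter a.

Lemma magnus_letterV a : magnus_letter a * magnus_letter (inv_letter a) = 1.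
Proof. by case: a => x [] /=; rewrite ?mul1X_inv ?mul_inv1X. Qed.

Lemma magnus_gen x : magnus (fg_gen x) = 1 + ncX x.
Proof. by rewrite /magnus big_seq1. Qed.

Lemma magnus1 : magnus 1%g = 1.
Proof. by rewrite /magnus big_nil. Qed.

Lemma magnusM g h : magnus (g * h)%g = magnus g * magnus h.
Proof.
rewrite /magnus -[fg_word (g * h)%g]/(foldr (@push X) (fg_word h) (fg_word g)).
have prod_push a w : \prod_(b <- push a w) magnus_letter b =
    magnus_letter a * \prod_(b <- w) magnus_letter b.
  case: w => [|b w] /=; first by rewrite big_seq1 big_nil mulr1.
  case: ifP => [/eqP ->|_]; last by rewrite big_cons.
  by rewrite big_cons mulrA magnus_letterV mul1r.
elim: (fg_word g) => [|a u IH] /=; first by rewrite big_nil mul1r.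
by rewrite prod_push IH big_cons mulrA.
Qed.

Lemma magnusVM g : magnus g^-1%g * magnus g = 1.
Proof. by rewrite -magnusM mulVg magnus1. Qed.

Lemma magnusMV g : magnus g * magnus g^-1%g = 1.
Proof. by rewrite -magnusM mulgV magnus1. Qed.

Definition order_ge (n : nat) (f : ncseries X) :=
  forall w, (size w < n)%N -> nccoef f w = 0.

Lemma order_geD n f f' : order_ge n f -> order_ge n f' -> order_ge n (f + f').
Proof. by move=> nf ng w sw; rewrite nccoefD nf // ng // addr0. Qed.

Lemma order_geN n f : order_ge n f -> order_ge n (- f).
Proof. by move=> nf w sw; rewrite nccoefN nf // oppr0. Qed.

Lemma order_geM m n f f' : order_ge m f -> order_ge n f' -> order_ge (m + n) (f * f').
Proof.
move=> mf ng w sw; rewrite nccoefM big1 // => i _.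
have iw : (i <= size w)%N by rewrite -ltnS.
have [im|im] := ltnP i m.
  by rewrite mf ?mul0r // size_take_min; apply: leq_ltn_trans im; apply: geq_minl.
by rewrite ng ?mulr0 // size_drop ltn_subLR //; apply: leq_trans sw _; rewrite leq_add2r.
Qed.

Lemma order_ge0 f : order_ge 0 f.
Proof. by []. Qed.

Lemma order_geMl n f f' : order_ge n f' -> order_ge n (f * f').
Proof. by move=> /(order_geM (@order_ge0 f)); rewrite add0n. Qed.

Lemma order_geMr n f f' : order_ge n f -> order_ge n (f * f').
Proof. by move=> /order_geM /(_ (@order_ge0 f')); rewrite addn0. Qed.

Lemma magnus_order1 g : order_ge 1 (magnus g - 1).
Proof.
rewrite /magnus; elim: (fg_word g) => [|a u IH]; first by rewrite big_nil subrr.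
rewrite big_cons.
have -> : magnus_letter a * \prod_(b <- u) magnus_letter b - 1 =
   magnus_letter a * (\prod_(b <- u) magnus_letter b - 1) + (magnus_letter a - 1).
  by rewrite mulrBr mulr1 addrA subrK.
apply: order_geD; first exact: order_geMl.
by case: a => x [] [|y w].
Qed.

Lemma magnus_lcs n g : lcs n g -> order_ge n (magnus g - 1).
Proof.
elim: n g => [//|[|n] IH] g; first by move=> _; apply: magnus_order1.
move=> /(_ [set h | order_ge n.+2 (magnus h - 1)]); apply.
  split=> [|a b /= na nb|a /= na]; first by rewrite /= magnus1 subrr.
  - have -> : magnus (a * b)%g - 1 = (magnus a - 1) * magnus b + (magnus b - 1).
      by rewrite magnusM mulrBl mul1r addrA subrK.
    by apply: order_geD => //; apply: order_geMr.
  - have -> : magnus a^-1%g - 1 = - (magnus a^-1%g * (magnus a - 1)).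
      by rewrite mulrBr magnusVM mulr1 opprB.
    by apply/order_geN/order_geMl.
move=> _ [a [b [la _ ->]]] /=; have na := IH _ la; have nb := magnus_order1 b.
have -> : magnus [~ a, b]%g - 1 = magnus a^-1%g * magnus b^-1%g *
   ((magnus a - 1) * (magnus b - 1) - (magnus b - 1) * (magnus a - 1)).
  have -> u v : (u - 1) * (v - 1) - (v - 1) * (u - 1) = u * v - v * u :> ncseries X.
    have E a' b' : (a' + 1) * (b' + 1) = a' * b' + (a' + b' + 1) :> ncseries X.
      by rewrite mulrDl mulrDr mul1r mulr1 !addrA.
    rewrite -{3 4}(subrK 1 u) -{3 4}(subrK 1 v) !E [u - 1 + _]addrC.
    by rewrite opprD addrACA subrr addr0.
  rewrite mulrBr commgEl conjgE !magnusM !mulrA; congr (_ - _).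
  by rewrite -[_ * magnus b]mulrA magnusVM mulr1 magnusVM.
apply: order_geMl; apply: order_geD; first by rewrite -addn1; apply: order_geM.
by apply: order_geN; rewrite -add1n; apply: order_geM.
Qed.

End Magnus.

Section Cohomology.
Variable G : groupType.

Definition cochain1 := G -> int.
Definition cochain2 := (G * G)%type -> int.
Definition cochain3 := (G * G * G)%type -> int.

HB.instance Definition _ := GRing.Zmodule.copy cochain1 (G -> int).
HB.instance Definition _ := GRing.Zmodule.copy cochain2 ((G * G)%type -> int).
HB.instance Definition _ := GRing.Zmodule.copy cochain3 ((G * G * G)%type -> int).

Definition diff1 (c : cochain1) : cochain2 :=
  fun p => let: (g, h) := p in c h - c (g * h)%g + c g.

Definition diff2 (c : cochain2) : cochain3 :=
  fun p => let: (g, h, k) := p in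
  c (h, k) - c (g * h, k)%g + c (g, h * k)%g - c (g, h).

Definition cup (c c' : cochain1) : cochain2 :=
  fun p => let: (g, h) := p in c g * c' h.

Lemma cochain2_sum (I : Type) (r : seq I) (P : pred I) (F : I -> cochain2) p :
  (\sum_(i <- r | P i) F i) p = \sum_(i <- r | P i) F i p.
Proof. by elim/big_rec2: _ => // i y c _ <-. Qed.

Lemma diff1B : {morph diff1 : c c' / c - c'}.
Proof.
move=> c c'; apply/funext => -[g h].
rewrite -[RHS]/(diff1 c (g, h) - diff1 c' (g, h)) /diff1.
have E x : (c - c') x = c x - c' x by [].
by rewrite !E; ring.
Qed.

Lemma diff2B : {morph diff2 : c c' / c - c'}.
Proof.
move=> c c'; apply/funext => -[[g h] k].
rewrite -[RHS]/(diff2 c (g, h, k) - diff2 c' (g, h, k)) /diff2.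
have E x : (c - c') x = c x - c' x by [].
by rewrite !E; ring.
Qed.

Lemma diff2_diff1 c : diff2 (diff1 c) = 0.
Proof.
apply/funext => -[[g h] k]; rewrite -[RHS]/(0 : int) /diff2 /diff1 mulgA; ring.
Qed.

Definition cocycles2 : {pred cochain2} := fun c => diff2 c == 0.

Lemma cocycles2_zmod : zmod_closed cocycles2.
Proof.
split; first by rewrite unfold_in; apply/eqP/funext => -[[g h] k].
move=> c c' /eqP dc /eqP dc'; apply/eqP; by rewrite diff2B dc dc' subrr.
Qed.

HB.instance Definition _ := GRing.isZmodClosed.Build cochain2 cocycles2 cocycles2_zmod.

Record Z2 := Cocycle2 { cocycle2_val : cochain2; _ : cocycle2_val \in cocycles2 }.

HB.instance Definition _ := [isSub for cocycle2_val].
HB.instance Definition _ := [Choice of Z2 by <:].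
HB.instance Definition _ := [SubChoice_isSubZmodule of Z2 by <:].

Definition B2 : {pred Z2} := fun z => `[< exists c, cocycle2_val z = diff1 c >].

Lemma B2_zmod : zmod_closed B2.
Proof.
split; first by apply/asboolP; exists 0; apply/funext => -[g h].
move=> z z' /asboolP[c zc] /asboolP[c' zc']; apply/asboolP; exists (c - c').
by rewrite diff1B -zc -zc'.
Qed.

HB.instance Definition _ := GRing.isZmodClosed.Build Z2 B2 B2_zmod.

Definition H2 := Quotient.quot B2.

HB.instance Definition _ := GRing.Zmodule.on H2.

Definition H2_class (c : cochain2) (cZ : c \in cocycles2) : H2 :=
  (\pi_H2 (Cocycle2 cZ))%qT.

End Cohomology.

Section GeneratedSubmodule.
Variable V : zmodType.

Definition zspan (S : set V) : {pred V} := fun v =>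
  `[< forall M : {pred V}, zmod_closed M -> (forall s, S s -> s \in M) -> v \in M >].

Lemma zspan_zmod S : zmod_closed (zspan S).
Proof.
split; first by apply/asboolP => M [].
move=> u v /asboolP Su /asboolP Sv; apply/asboolP => M cM SM.
by case: (cM) => _; apply; [apply: Su|apply: Sv].
Qed.

HB.instance Definition _ S := GRing.isZmodClosed.Build V (zspan S) (zspan_zmod S).

Record span_of (S : set V) := SpanOf { span_val : V; _ : span_val \in zspan S }.

HB.instance Definition _ S := [isSub for @span_val S].
HB.instance Definition _ S := [Choice of span_of S by <:].
HB.instance Definition _ S := [SubChoice_isSubZmodule of span_of S by <:].

End GeneratedSubmodule.

Section Massey.
Variables (X : choiceType) (n : nat).

Definition F_mod_lcs : groupType := quotient_group (lcs_normal (freegroup X) n).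

(* the subword x_i ... x_(j-1) of w = x_1 ... x_n, for 1 <= i < j <= n + 1 *)
Definition subword (w : seq X) (i j : nat) : seq X := drop i.-1 (take j.-1 w).

(* By massey_cochain_proj the chosen representative of the class q plays no
   role in the range of indices where the cochain is used. *)
Definition massey_cochain (w : seq X) (i j : nat) : cochain1 F_mod_lcs :=
  fun q => (-1) ^+ (j - i) * nccoef (magnus (repr q)) (subword w i j).

Definition massey_value (w : seq X) : cochain2 F_mod_lcs :=
  \sum_(2 <= k < n.+1) cup (massey_cochain w 1 k) (massey_cochain w k n.+1).

Lemma nccoef_magnus_proj (g h : freegroup X) (u : seq X) :
  proj (lcs_normal (freegroup X) n) g = proj (lcs_normal (freegroup X) n) h ->
  (size u < n)%N -> nccoef (magnus g) u = nccoef (magnus h) u.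
Proof.
move=> /proj_eq /= /magnus_lcs gh un.
have -> : magnus h = magnus g * (magnus (g^-1 * h)%g - 1) + magnus g.
  by rewrite mulrBr mulr1 -magnusM mulVKg subrK.
by rewrite nccoefD (@order_geMl _ n _ _ gh) // add0r.
Qed.

Lemma size_subword (w : seq X) i j : (0 < i)%N -> (i < j)%N ->
  (j <= (size w).+1)%N -> size (subword w i j) = (j - i)%N.
Proof.
move=> i0 ij jw; rewrite /subword size_drop size_take_min.
have -> : minn j.-1 (size w) = j.-1 by apply/minn_idPl; lia.
lia.
Qed.

Lemma massey_cochain_proj (w : seq X) i j g : size w = n ->
  (0 < i)%N -> (i < j)%N -> (j <= n.+1)%N -> (i, j) <> (1, n.+1)%N ->
  massey_cochain w i j (proj (lcs_normal (freegroup X) n) g) =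
    (-1) ^+ (j - i) * nccoef (magnus g) (subword w i j).
Proof.
move=> wn i0 ij jn ij1; congr (_ * _).
apply: nccoef_magnus_proj; first by rewrite reprP.
rewrite size_subword ?wn //.
have : ~ (i = 1%N /\ j = n.+1) by case=> ? ?; apply: ij1; congr pair.
lia.
Qed.

Lemma take_subword (w : seq X) i j k : (0 < i)%N -> (i <= k)%N -> (k <= j)%N ->
  take (k - i) (subword w i j) = subword w i k.
Proof.
move=> i0 ik kj; rewrite /subword take_drop -take_min; congr (drop _ (take _ _)).
lia.
Qed.

Lemma drop_subword (w : seq X) i j k : (0 < i)%N -> (i <= k)%N -> (k <= j)%N ->
  drop (k - i) (subword w i j) = subword w k j.
Proof. by move=> i0 ik kj; rewrite /subword drop_drop; congr drop; lia. Qed.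

Lemma magnus_cut (w : seq X) i j g h : size w = n ->
  (0 < i)%N -> (i < j)%N -> (j <= n.+1)%N ->
  nccoef (magnus (g * h)%g) (subword w i j) =
    nccoef (magnus g) (subword w i j) + nccoef (magnus h) (subword w i j) +
    \sum_(i.+1 <= k < j) nccoef (magnus g) (subword w i k) *
                         nccoef (magnus h) (subword w k j).
Proof.
move=> wn i0 ij jn.
have const f : nccoef (magnus f) [::] = 1.
  by apply/eqP; rewrite -subr_eq0; apply/eqP; apply: (magnus_order1 f).
have [m jE] : exists m, j = (i + m.+1)%N by exists (j - i).-1; lia.
rewrite magnusM nccoefM size_subword ?wn //.
have -> : (j - i)%N = m.+1 by lia.
rewrite big_ord_recl big_ord_recr /= take0 drop0 const mul1r.
have si := size_subword i0 ij (eq_ind_r (fun k => j <= k.+1)%N jn wn).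
have -> : take m.+1 (subword w i j) = subword w i j by rewrite take_oversize ?si //; lia.
have -> : drop m.+1 (subword w i j) = [::] by rewrite drop_oversize ?si //; lia.
rewrite const mulr1; set L := \sum_(_ < m) _; set R := \sum_(_ <= _ < _) _.
suff -> : L = R by ring.
rewrite {}/L {}/R.
rewrite -{1}[i.+1]add0n big_addn.
have -> : (j - i.+1 = m)%N by lia.
rewrite big_mkord; apply: eq_bigr => k _; have km := ltn_ord k.
rewrite /bump /= add1n.
have -> : (widen_ord (leqnSn m) k).+1 = ((k + i.+1) - i)%N by rewrite /=; lia.
by rewrite take_subword ?drop_subword //; lia.
Qed.

Lemma massey_cochain_diff (w : seq X) i j : size w = n ->
  (0 < i)%N -> (i < j)%N -> (j <= n.+1)%N -> (i, j) <> (1, n.+1)%N ->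
  diff1 (massey_cochain w i j) =
    - \sum_(i.+1 <= k < j) cup (massey_cochain w i k) (massey_cochain w k j).
Proof.
move=> wn i0 ij jn ij1; apply/funext => -[a b].
rewrite -[a]reprP -[b]reprP; move: (repr a) (repr b) => g h.
rewrite -[RHS]/(- ((\sum_(i.+1 <= k < j) _ : cochain2 _) _)) cochain2_sum /diff1.
rewrite -projM !massey_cochain_proj // magnus_cut //.
set S := \sum_(_ <= k < _) _ * _; set T := \sum_(_ <= _ < _) _.
suff -> : T = (-1) ^+ (j - i) * S by ring.
rewrite /T /S mulr_sumr; apply: eq_big_nat => k /andP[ik kj]; rewrite /cup !massey_cochain_proj //; try lia.
- have -> : (j - i = (k - i) + (j - k))%N by lia.
  by rewrite exprD; ring.
- by case; lia.
- by case; lia.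
Qed.

Lemma massey_value_cocycle (w : n.-tuple X) : massey_value w \in @cocycles2 F_mod_lcs.
Proof.
have [n0|n0] := posnP n.
  by rewrite /massey_value big_geq ?rpred0 // n0.
have E g h : massey_value w (proj _ g, proj _ h) = (-1) ^+ n *
   (nccoef (magnus (g * h)%g) w - nccoef (magnus g) w - nccoef (magnus h) w).
  have ws : subword w 1 n.+1 = w by rewrite /subword drop0 take_oversize ?size_tuple.
  have := @magnus_cut w 1 n.+1 g h (size_tuple w) isT n0 (leqnn _).
  rewrite ws => ->; rewrite /massey_value cochain2_sum.
  set S := \sum_(_ <= k < _) _ * _; set T := \sum_(_ <= _ < _) _.
  suff -> : T = (-1) ^+ n * S by ring.
  rewrite /T /S mulr_sumr; apply: eq_big_nat => k /andP[k2 kn]; rewrite /cup !massey_cochain_proj ?size_tuple //; try lia.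
  - have -> : (-1) ^+ n = (-1) ^+ (k - 1) * (-1) ^+ (n.+1 - k) :> int.
      by rewrite -exprD; congr (_ ^+ _); lia.
    by ring.
  - by case; lia.
  - by case; lia.
apply/eqP/funext => -[[a b] c]; rewrite -[RHS]/(0 : int) /diff2.
rewrite -[a]reprP -[b]reprP -[c]reprP; move: (repr a) (repr b) (repr c) => g h k.
by rewrite -!projM !E mulgA; ring.
Qed.

Definition psi (w : n.-tuple X) : H2 F_mod_lcs := H2_class (massey_value_cocycle w).

Definition H2_massey : zmodType := span_of (range psi).

End Massey.

(* None stands for infinity. *)
Definition cardinal (T : choiceType) : option nat :=
  if `[< finite_set [set: T] >] then Some #|` fset_set [set: T] |%fset else None.

Definition mobius (d : nat) : int :=
  if all (fun p => logn p d == 1%N) (primes d) then (-1) ^+ size (primes d) else 0.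

Definition necklace (m : option nat) (n : nat) : option rat :=
  omap (fun m => n%:R^-1 * \sum_(d <- divisors n) (mobius d)%:~R * m%:R ^+ (n %/ d)) m.

Definition is_basis (V : zmodType) (B : choiceType) (b : B -> V) : Prop :=
  forall v : V, exists! c : {fsfun B -> int with 0},
    v = \sum_(i <- finsupp c) b i *~ c i.

Definition free_of_rank (V : zmodType) (r : option rat) : Prop :=
  exists (B : choiceType) (b : B -> V),
    is_basis b /\ omap (fun k => k%:R) (cardinal B) = r.

(* Main.v *)
Require Import Defs.
From mathcomp Require Import all_boot all_order all_algebra.
From mathcomp Require Import finmap all_classical.
From HB Require Import structures.
From mathcomp Require Import wochoice zify ring.

Set Implicit Arguments.
Unset Strict Implicit.
Unset Printing Implicit Defensive.

Import Order.TTheory GRing.Theory Num.Theory.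
Import Order.DefaultSeqLexiOrder.

(** Write [mu_w g] for the coefficient of the word [w] in the Magnus expansion
    of [g]. On the free group the cocycle representing [psi w] is, up to the
    sign [(-1) ^+ n], the coboundary of [mu_w] for the word [w] of length [n]:
    its value at [(g, h)] is [mu_w (g * h) - mu_w g - mu_w h]. Hence a
    combination of the classes [psi w] vanishes if and only if the same
    combination of the functions [mu_w] vanishes on the n-th term of the lower
    central series (transgression in degree two, [psi_sum_eq0]). The degree [n]
    parts of the Magnus expansions of the elements of that term form exactly the
    degree [n] part [lie n] of the free Lie ring ([leading_part_lie],
    [lie_leading_part]). So the group generated by the [psi w] is the group of
    functionals on [lie n] generated by the coefficients at the words of length
    [n].

    Order the letters, and bracket every Lyndon word along its standard
    factorization. The resulting polynomial [lyndon_poly w] is [w] plus a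
    combination of larger rearrangements of [w] ([lyndon_poly_triangular]), and
    these polynomials span [lie n] ([lie_lyndon_span]). The matrix of the
    coefficients of the [lyndon_poly w] at Lyndon words is therefore
    unitriangular, so that the [psi w] for [w] Lyndon are linearly independent;
    and for any word [u], solving the finite unitriangular system indexed by the
    Lyndon rearrangements of [u] expresses [psi u] through them. This is the
    basis ([massey_basisP]).

    It remains to count Lyndon words of length [n]. A primitive word has exactly
    one Lyndon rotation among its [n] rotations, and Moebius inversion over the
    exponents of the words of length [n] counts the primitive ones
    ([necklace_count_lyndon]). If there are infinitely many letters, there are
    infinitely many Lyndon words, because every letter occurs in one of them. *)

(** * Lyndon words *)

Section LyndonWords.
Variables (d : Order.disp_t) (X : orderType d).
Implicit Types (x y : X) (a b s t u v w : seq X).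
Local Open Scope order_scope.

Lemma ltxi_cat2l u v w : (u ++ v < u ++ w) = (v < w).
Proof. by elim: u => //= x u IH; rewrite ltxi_cons lexx. Qed.

Lemma lexi_cat2l u v w : (u ++ v <= u ++ w) = (v <= w).
Proof. by rewrite !leNgt ltxi_cat2l. Qed.

Lemma ltxi_catl u v : v != [::] -> u < u ++ v.
Proof. by move=> v0; rewrite -[ltLHS]cats0 ltxi_cat2l; case: v v0. Qed.

(** In the second case the words differ at some letter, so that no continuation
    can reverse the comparison. *)
Lemma ltxiP u v : u < v ->
  (exists2 s : seq X, s != [::] & v = u ++ s) \/ (forall a b, u ++ a < v ++ b).
Proof.
elim: u v => [|x u IH] [|y v] //; first by left; exists (y :: v).
rewrite ltxi_cons => /andP[xy yx].
have [yx'|nyx] := boolP (y <= x).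
  have exy : x = y by apply/eqP; rewrite eq_le xy yx'.
  rewrite yx' /= in yx; case: (IH _ yx) => [[s s0 ->]|H].
    by left; exists s; rewrite ?exy.
  by right=> a b; rewrite /= exy eqhead_ltxiE.
right=> a b /=; rewrite neqhead_ltxiE; first by rewrite ltNge.
by apply: contraNneq nyx => ->.
Qed.

Lemma ltxi_cat_size u v a b : size u = size v -> u < v -> u ++ a < v ++ b.
Proof.
move=> suv /ltxiP[[s s0 vE]|]; last exact.
by move: suv; rewrite vE size_cat -[LHS]addn0 => /addnI /esym /size0nil s0'; rewrite s0' in s0.
Qed.

Lemma lexi_cat_size u v a b :
  size u = size v -> u <= v -> a <= b -> u ++ a <= v ++ b.
Proof.
move=> suv; rewrite le_eqVlt => /orP[/eqP ->|uv ab]; first by rewrite lexi_cat2l.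
exact/ltW/ltxi_cat_size.
Qed.

Definition lyndon w : bool :=
  (w != [::]) && all (fun i => w < drop i w) (iota 1 (size w).-1).

Lemma lyndonP w : reflect
  (w != [::] /\ forall a b, a != [::] -> b != [::] -> w = a ++ b -> w < b)
  (lyndon w).
Proof.
apply: (iffP andP) => -[w0 H]; split=> //.
  move=> a b a0 b0 wE; have := allP H (size a).
  rewrite mem_iota wE drop_size_cat // size_cat; apply.
  rewrite lt0n size_eq0 a0 /= add1n prednK ?addn_gt0 ?lt0n ?size_eq0 ?a0 //.
  by rewrite -[ltnLHS]addn0 ltn_add2l lt0n size_eq0.
apply/allP => i; rewrite mem_iota => /andP[i0 iw].
have {}iw : (i < size w)%N.
  by move: iw; rewrite add1n prednK // lt0n size_eq0.
apply: (H (take i w)); last by rewrite cat_take_drop.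
  by rewrite -size_eq0 size_takel ?(ltnW iw) // -lt0n.
by rewrite -size_eq0 size_drop subn_eq0 -ltnNge.
Qed.

Lemma lyndon_neq0 w : lyndon w -> w != [::].
Proof. by case/andP. Qed.

Lemma lyndon_suffix w a b : lyndon w -> a != [::] -> b != [::] ->
  w = a ++ b -> w < b.
Proof. by case/lyndonP => _; apply. Qed.

Lemma lyndon1 x : lyndon [:: x].
Proof. by []. Qed.

Lemma lyndon_cat_lt u v : lyndon u -> lyndon v -> u < v -> u ++ v < v.
Proof.
move=> lu lv /ltxiP[[s s0 vE]|H]; last by have := H v [::]; rewrite cats0.
by rewrite [ltRHS]vE ltxi_cat2l; apply: lyndon_suffix vE => //; apply: lyndon_neq0.
Qed.

Lemma cat_eq_cat (T : Type) (u v a b : seq T) : u ++ v = a ++ b ->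
  (exists c, a = u ++ c /\ v = c ++ b) \/
  (exists (z : T) (c : seq T), u = a ++ z :: c /\ b = z :: c ++ v).
Proof.
elim: u a => [|y u IH] [|z a] /=.
- by move=> ->; left; exists [::].
- by move=> ->; left; exists (z :: a).
- by move=> <-; right; exists y, u.
- case=> -> /IH [[c [-> ->]]|[x [c [-> ->]]]]; first by left; exists c.
  by right; exists x, c.
Qed.

(** A suffix of [u ++ v] either is one of [v], hence at least [v > u ++ v], or is
    [s ++ v] for a proper suffix [s] of [u]. In the latter case [s > u] is shorter than
    [u], so the comparison is decided at a letter and survives concatenation. *)
Lemma lyndon_cat u v : lyndon u -> lyndon v -> u < v -> lyndon (u ++ v).
Proof.
move=> lu lv uv; have uvv := lyndon_cat_lt lu lv uv.
apply/lyndonP; split=> [|a b a0 b0].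
  by apply: contraNneq (lyndon_neq0 lu); case: (u).
case/cat_eq_cat => [[c [_ vE]]|[x [c [uE bE]]]].
  have [c0|c0] := eqVneq c [::]; first by rewrite vE c0 in uvv *.
  exact: lt_trans uvv (lyndon_suffix lv c0 b0 vE).
have xu : u < x :: c by exact: lyndon_suffix uE.
rewrite bE -cat_cons; have [[s s0 sE]|//] := ltxiP xu.
have := congr1 size uE; rewrite sE !size_cat -[LHS]addn0 => /eqP.
rewrite addnCA eqn_add2l eq_sym addn_eq0 !size_eq0.
by rewrite (negbTE a0).
Qed.

Fixpoint min_suffix w : seq X :=
  if w is x :: w' then
    if w' is [::] then w else Order.min w (min_suffix w')
  else [::].

Lemma min_suffix_neq0 w : w != [::] -> min_suffix w != [::].
Proof. by elim: w => // x [|y w] //= IH _; rewrite minElt; case: ifP => // _; apply: IH. Qed.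

Lemma min_suffix_suffix w : exists a, w = a ++ min_suffix w.
Proof.
elim: w => [|x w [a IH]]; first by exists [::].
case: w IH => [|y w] IH /=; first by exists [::].
by rewrite minElt; case: ifP => _; [exists [::]|exists (x :: a); rewrite cat_cons -IH].
Qed.

Lemma min_suffix_le w a b : w = a ++ b -> b != [::] -> min_suffix w <= b.
Proof.
elim: w a => [|x w IH] a /=; first by case: a => //= <-.
case: w IH => [|y w] IH; first by case: a => [/= <- //|z [|? ?]] //= [_ <-].
case: a => [/= <-|z a [_ wE]] b0; rewrite ge_min; first by rewrite lexx.
by rewrite (IH _ wE b0) orbT.
Qed.

(** The pair [(u, v)] is the standard factorization of the Lyndon word [u ++ v],
    the one whose right factor is the smallest proper suffix. Being Lyndon, [v] is
    below its own proper suffixes, so comparing it with those of [u] suffices. *)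
Definition standard u v : Prop :=
  [/\ lyndon u, lyndon v, u < v &
      forall a b, a != [::] -> b != [::] -> u = a ++ b -> v <= b].

(** Let [v] be the smallest proper suffix of [w = u ++ v], and [c] a proper suffix
    of [u]. Suppose that [c < u]. If [c] is not a prefix of [u], then
    [c ++ v < u ++ v], although [w] is Lyndon; if [u = c ++ s], then
    [w < c ++ v] cancels to [s ++ v < v], against the choice of [v]. Hence [u] is
    Lyndon. Similarly, [c < v <= c ++ v] would give [v = c ++ s] with [s <= v],
    although [v] is Lyndon. *)
Lemma standard_factorization w : lyndon w -> (1 < size w)%N ->
  exists u v, w = u ++ v /\ standard u v.
Proof.
case: w => [|x [|y w']] // lw _; set w := y :: w' in lw *.
have [a wE] := min_suffix_suffix w; set v := min_suffix w in wE.
have v0 : v != [::] by apply: min_suffix_neq0.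
have vle b c : x :: w = b ++ c -> b != [::] -> c != [::] -> v <= c.
  by case: b => // z b [_ wE'] _; apply: min_suffix_le wE'.
have xwE : x :: w = (x :: a) ++ v by rewrite wE.
have neq_cat (s t : seq X) : s != [::] -> s ++ t != t.
  by move=> s0; apply: contraNneq s0 => /(congr1 size)/eqP; rewrite size_cat -[eqbRHS]add0n eqn_add2r size_eq0.
have lv : lyndon v.
  apply/lyndonP; split=> // b c b0 c0 vE; rewrite lt_neqAle; apply/andP; split.
    by rewrite vE neq_cat.
  by apply: (vle ((x :: a) ++ b)) => //; rewrite xwE vE catA.
have wv : x :: w < v by apply: lyndon_suffix xwE.
have lu : lyndon (x :: a).
  apply/lyndonP; split=> // b c b0 c0 uE.
  have wcv : x :: w < c ++ v.
    apply: lyndon_suffix b0 _ _ => //; last by rewrite catA -uE.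
    by case: (c) c0.
  rewrite ltNge; apply/negP => cu.
  have ncu : c != x :: a by rewrite uE eq_sym neq_cat.
  have {cu ncu} /ltxiP[[s s0 sE]|H] : c < x :: a by rewrite lt_neqAle ncu.
    move: wcv; rewrite xwE sE -catA ltxi_cat2l => svv.
    have : v <= s ++ v.
      apply: (vle c); rewrite ?xwE ?sE ?catA //.
      by case: (s) s0.
    by rewrite leNgt svv.
  by have := lt_trans wcv (H v v); rewrite -xwE ltxx.
exists (x :: a), v; split => //; split=> //.
  by apply: lt_trans wv; rewrite xwE ltxi_catl.
move=> b c b0 c0 uE; have cv : v <= c ++ v.
  apply: (vle b); rewrite ?xwE ?uE ?catA //.
  by case: (c) c0.
rewrite leNgt; apply/negP => cv'; have [[s s0 vE]|H] := ltxiP cv'; last first.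
  by have := H v [::]; rewrite cats0 ltNge cv.
move: cv; rewrite {1}vE lexi_cat2l leNgt => /negP; apply.
exact: lyndon_suffix lv c0 s0 vE.
Qed.

Lemma standard_cat u v : standard u v -> lyndon (u ++ v).
Proof. by case=> lu lv uv _; apply: lyndon_cat. Qed.

Lemma standard_min_suffix u v : standard u v -> min_suffix (behead (u ++ v)) = v.
Proof.
case=> lu lv uv H; have := lyndon_neq0 lu; have v0 := lyndon_neq0 lv.
case: u lu uv H => [//|x u] lu uv H _ /=.
set m := min_suffix _; have [a mE] : exists a, u ++ v = a ++ m by apply: min_suffix_suffix.
have m0 : m != [::].
  by apply: min_suffix_neq0; case: (u) => //; case: (v) v0.
apply: le_anti; rewrite (min_suffix_le (erefl _) v0) /=.
case/cat_eq_cat: mE => [[c [_ vE]]|[y [c [uE ->]]]].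
  by have [c0|c0] := eqVneq c [::]; [rewrite vE c0|apply/ltW/(lyndon_suffix lv c0 m0 vE)].
have := H (x :: a) (y :: c) isT isT; rewrite uE => /(_ erefl) vc.
by apply: le_trans vc _; rewrite -cat_cons; apply/ltW/ltxi_catl.
Qed.

(** In the second case [(u, v)] is not standard, and the bracket of [u] with [v]
    has to be rewritten with the Jacobi identity. *)
Lemma standard_or u v : lyndon u -> lyndon v -> u < v ->
  standard u v \/ exists u1 u2, [/\ u = u1 ++ u2, standard u1 u2 & u2 < v].
Proof.
move=> lu lv uv; have [su|su] := ltnP 1 (size u); last first.
  left; split=> // a b a0 b0 uE; move: su; rewrite uE size_cat.
  by case: a a0 {uE} => // x a _; case: b b0 => // y b _; rewrite /= addnS.
have [u1 [u2 [uE std]]] := standard_factorization lu su.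
have [u2v|vu2] := ltP u2 v; first by right; exists u1, u2.
left; split=> // a b a0 b0 uE'; apply: le_trans vu2 _.
have [lu1 lu2 u12 H] := std; move: uE'; rewrite uE => /cat_eq_cat.
case=> [[c [_ u2E]]|[y [c [u1E ->]]]].
  by have [c0|c0] := eqVneq c [::]; [rewrite u2E c0|apply/ltW/(lyndon_suffix lu2 c0 b0 u2E)].
by apply: le_trans (H a (y :: c) a0 isT u1E) _; rewrite -cat_cons; apply/ltW/ltxi_catl/lyndon_neq0.
Qed.

End LyndonWords.

(** * Counting Lyndon words *)

Section Mobius.
Local Open Scope ring_scope.
Implicit Types (d e p q : nat).

Lemma mobius_mul_prime p d : prime p -> (0 < d)%N -> ~~ (p %| d)%N ->
  mobius (p * d) = - mobius d.
Proof.
move=> pp d0 pd; have p0 := prime_gt0 pp.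
have perm_primes : perm_eq (primes (p * d)) (p :: primes d).
  apply: uniq_perm; rewrite ?primes_uniq //= ?primes_uniq ?andbT.
    by rewrite mem_primes pp d0.
  by move=> q; rewrite primesM // inE primes_prime // inE.
rewrite /mobius (perm_all _ perm_primes) (perm_size perm_primes) /=.
rewrite lognM // logn_prime // eqxx (_ : logn p d = 0%N) /=; last first.
  by apply/eqP; rewrite -leqn0 leqNgt logn_gt0 mem_primes pp d0.
rewrite (_ : all _ (primes d) = all (fun q => logn q d == 1%N) (primes d)).
  by case: ifP => _; rewrite ?oppr0 // exprS mulN1r.
apply: eq_in_all => q qd; rewrite lognM // logn_prime //.
have -> : (q == p) = false; last by [].
by apply: contraNF pd => /eqP <-; move: qd; rewrite mem_primes => /and3P[].
Qed.

Lemma mobius_square p d : prime p -> (0 < d)%N -> (p ^ 2 %| d)%N -> mobius d = 0.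
Proof.
move=> pp d0 ppd; rewrite /mobius; case: ifP => // /allP /(_ p).
rewrite mem_primes pp d0 (dvdn_trans _ ppd) ?dvdn_exp // => /(_ isT) /eqP H.
by move: ppd; rewrite pfactor_dvdn // H.
Qed.

(** Pairing [d] with [p * d], for a prime [p] dividing [e], cancels all terms. *)
Lemma sum_mobius e : (0 < e)%N -> \sum_(d <- divisors e) mobius d = (e == 1%N)%:R.
Proof.
move=> e0; have [->|e1] := eqVneq e 1%N; first by rewrite big_seq1.
have pp : prime (pdiv e) by rewrite pdiv_prime //; lia.
have pe : (pdiv e %| e)%N by exact: pdiv_dvd.
move: (pdiv e) pp pe => p pp pe; have p0 := prime_gt0 pp.
rewrite (bigID (fun d => p %| d)%N) /= (bigID (fun d => p ^ 2 %| d)%N) /=.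
rewrite big_seq_cond big1 ?add0r => [|d /and3P[de _ pd]]; last first.
  by apply: mobius_square pd => //; apply: (dvdn_gt0 e0); rewrite dvdn_divisors.
rewrite -big_filter -[X in _ + X]big_filter.
rewrite [X in X + _](perm_big [seq (p * d)%N | d <- [seq d <- divisors e | ~~ (p %| d)%N]]) /=.
  rewrite big_map !big_filter -big_split /= big_seq_cond big1 // => d /andP[de pd].
  by rewrite mobius_mul_prime ?addNr //; apply: (dvdn_gt0 e0); rewrite dvdn_divisors.
apply: uniq_perm; rewrite ?filter_uniq ?divisors_uniq //.
  rewrite map_inj_uniq ?filter_uniq ?divisors_uniq // => d d'.
  by move/eqP; rewrite eqn_pmul2l // => /eqP.
move=> d; rewrite mem_filter; apply/andP/mapP => [[/andP[pd ppd] de]|[d' ]].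
  case/dvdnP: pd ppd de => d' -> ppd de; exists d'; last by rewrite mulnC.
  rewrite mem_filter; apply/andP; split.
    by apply: contra ppd; rewrite expnS expn1 mulnC; apply: dvdn_mul.
  by move: de; rewrite -!dvdn_divisors // => /(dvdn_trans _); apply; apply: dvdn_mulr.
rewrite mem_filter -dvdn_divisors // => /andP[pd' de] ->; split.
  by rewrite dvdn_mulr // expnS expn1 dvdn_pmul2l.
rewrite -dvdn_divisors // Gauss_dvd ?pe ?de //.
by rewrite prime_coprime.
Qed.

End Mobius.

Section Words.
Local Open Scope ring_scope.
Variable T : eqType.
Implicit Types (E : seq T) (w u v : seq T).

Fixpoint words E (k : nat) : seq (seq T) :=
  if k is k'.+1 then [seq x :: w | x <- E, w <- words E k'] else [:: [::]].

Lemma mem_words E k w : (w \in words E k) = (size w == k) && all (mem E) w.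
Proof.
elim: k w => [|k IH] [|x w] //=; first by apply/allpairsP => -[[y v] []].
rewrite eqSS; apply/allpairsP/and3P => [[[y v] /= [yE + [-> ->]]]|[wk xE wE]].
  by rewrite IH => /andP[-> ->]; rewrite yE.
by exists (x, w); rewrite IH wk wE.
Qed.

Lemma words_uniq E k : uniq E -> uniq (words E k).
Proof.
move=> uE; elim: k => //= k IH; apply: allpairs_uniq => //.
by move=> [x w] [y v] _ _ [-> ->].
Qed.

Lemma size_words E k : size (words E k) = (size E ^ k)%N.
Proof. by elim: k => //= k IH; rewrite size_allpairs IH expnS. Qed.

Definition primitive w : bool := all (fun k => rot k w != w) (iota 1 (size w).-1).

Lemma primitiveP w :
  reflect (forall k, (0 < k < size w)%N -> rot k w != w) (primitive w).
Proof.
apply: (iffP allP) => H k => [/andP[k0 kw]|]; first by apply: H; rewrite mem_iota; lia.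
by rewrite mem_iota => kw; apply: H; lia.
Qed.

Definition power u k : seq T := flatten (nseq k u).

Lemma size_power u k : size (power u k) = (k * size u)%N.
Proof. by elim: k => //= k IH; rewrite size_cat IH mulSn. Qed.

Lemma power_rcons u k : power u k ++ u = u ++ power u k.
Proof. by elim: k => [|k IH] /=; [rewrite cats0|rewrite -catA IH]. Qed.

Lemma rot_power u k : rot (size u) (power u k) = power u k.
Proof.
case: k => [|k]; first by rewrite /rot.
by rewrite rot_size_cat power_rcons.
Qed.

(** A word commuting with [u] and at least as long starts with [u], and what
    remains still commutes with [u]. *)
Lemma commuting_power u v k : size v = (k * size u)%N -> v ++ u = u ++ v -> v = power u k.
Proof.
elim: k v => [|k IH] v; first by move/size0nil.
move=> sv vu; have vE : v = u ++ drop (size u) v.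
  have := congr1 (take (size u)) vu.
  rewrite takel_cat ?sv ?mulSn ?leq_addr // take_size_cat // => uE.
  by rewrite -{1}uE cat_take_drop.
rewrite vE /=; congr (_ ++ _); apply: IH; first by rewrite size_drop sv mulSn addKn.
by move: vu; rewrite {1 2}vE -catA => /eqP; rewrite eqseq_cat // => /andP[_ /eqP].
Qed.

Lemma rot_fixed_power w k d : size w = (d * k)%N -> (0 < d)%N ->
  rot k w = w -> w = power (take k w) d.
Proof.
case: d => // d; rewrite mulSn => sw _ wE.
have kw : (k <= size w)%N by rewrite sw leq_addr.
rewrite -{1}(cat_take_drop k w) /=; congr (_ ++ _).
apply: commuting_power; first by rewrite size_drop size_takel // sw addKn.
by rewrite cat_take_drop.
Qed.

(** The words of length [d * k] fixed by [rot k] are the d-th powers of the words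
    of length [k]. *)
Lemma count_rot_fixed E d k : uniq E -> (0 < d)%N ->
  count (fun w => rot k w == w) (words E (d * k)) = (size E ^ k)%N.
Proof.
move=> uE d0; rewrite -size_filter -size_words -(size_map (power^~ d) (words E k)).
apply: perm_size; apply: uniq_perm; first by rewrite filter_uniq ?words_uniq.
  rewrite map_inj_in_uniq ?words_uniq // => u v; rewrite !mem_words.
  case: d d0 => // d _ /andP[/eqP su _] /andP[/eqP sv _] /= /eqP.
  by rewrite eqseq_cat ?su ?sv // => /andP[/eqP].
move=> w; rewrite mem_filter mem_words; apply/and3P/mapP => [[/eqP wE /eqP sw Ew]|[u + ->]].
  exists (take k w); last exact: rot_fixed_power.
  rewrite mem_words size_takel ?eqxx /=; last by rewrite sw leq_pmull.
  by apply/allP => x /mem_take; apply: (allP Ew).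
rewrite mem_words => /andP[/eqP <- uE']; rewrite rot_power size_power eqxx; split=> //.
by apply/allP => x /flattenP[v /nseqP[-> _]]; apply: (allP uE').
Qed.

(** Here [p] is the least period of [w]. *)
Lemma rot_period w : (0 < size w)%N -> exists2 p, (0 < p)%N &
  forall k, (k <= size w)%N -> (rot k w == w) = (p %| k)%N.
Proof.
move=> w0; have ex_p : exists k, (0 < k)%N && (rot k w == w).
  by exists (size w); rewrite w0 rot_size eqxx.
case: (ex_minnP ex_p) => p /andP[p0 /eqP pw] pmin; exists p => // k.
have [m] := ubnP k; elim: m k => // m IH k km kw.
have [->|k0] := posnP k; first by rewrite rot0 eqxx dvdn0.
have [kp|pk] := ltnP k p.
  rewrite gtnNdvd //; apply/negP => kw'; have := pmin k.
  by rewrite k0 kw' => /(_ isT); rewrite leqNgt kp.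
rewrite -{1 2}(subnK pk) rotD ?subnK // pw IH ?dvdn_subl //; lia.
Qed.

(** If [p] is the least period of [w], then [w] is a d-th power exactly when [d]
    divides [size w %/ p], and [w] is primitive exactly when this number is 1. *)
Lemma mobius_primitive w : (0 < size w)%N ->
  \sum_(d <- divisors (size w)) mobius d * (rot (size w %/ d) w == w)%:R =
  (primitive w)%:R :> int.
Proof.
move=> w0; have [p p0 pP] := rot_period w0.
have /dvdnP[e we] : (p %| size w)%N by rewrite -pP // rot_size.
have e0 : (0 < e)%N by move: w0; rewrite we muln_gt0 => /andP[].
rewrite (eq_big_seq (fun d => if (d %| e)%N then mobius d else 0)) => [|d].
  rewrite -big_mkcond /= -big_filter.
  rewrite (perm_big (divisors e)) /=.
    rewrite sum_mobius //; congr (nat_of_bool _)%:R.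
    apply/eqP/primitiveP => [e1 k /andP[k0 kw]|H].
      by rewrite pP ?(ltnW kw) // gtnNdvd // -[p]mul1n -e1 -we.
    apply/eqP; rewrite eqn_leq e0 andbT leqNgt; apply/negP => e1.
    have pw : (0 < p < size w)%N by rewrite p0 we -[ltnLHS]mul1n ltn_pmul2r.
    by have := H p pw; rewrite pP ?dvdnn //; case/andP: pw => _ /ltnW.
  apply: uniq_perm; rewrite ?filter_uniq ?divisors_uniq // => d.
  rewrite mem_filter -!dvdn_divisors //; apply: andb_idr => de.
  by rewrite we dvdn_mulr.
rewrite -dvdn_divisors // => /dvdnP[q wq].
have d0 : (0 < d)%N by move: w0; rewrite wq muln_gt0 => /andP[].
rewrite wq mulnK // pP; last by rewrite wq leq_pmulr.
have -> : (p %| q)%N = (d %| e)%N.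
  by rewrite -(dvdn_pmul2r d0) -wq we mulnC dvdn_pmul2r.
by case: ifP; rewrite ?mulr1 ?mulr0.
Qed.

Lemma count_primitive E n : uniq E -> (0 < n)%N ->
  (count primitive (words E n))%:R =
  \sum_(d <- divisors n) mobius d * (size E)%:R ^+ (n %/ d) :> int.
Proof.
move=> uE n0; transitivity (\sum_(w <- words E n) (primitive w)%:R : int).
  by rewrite -sum1_count natr_sum big_mkcond; apply: eq_bigr => w _; case: ifP.
rewrite (eq_big_seq (fun w => \sum_(d <- divisors n)
    mobius d * (rot (n %/ d) w == w)%:R)) => [|w]; last first.
  by rewrite mem_words => /andP[/eqP wn _]; rewrite -mobius_primitive wn.
rewrite exchange_big /=; apply: eq_big_seq => d.
rewrite -dvdn_divisors // => dn; rewrite -mulr_sumr; congr (_ * _).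
have d0 : (0 < d)%N by apply: dvdn_gt0 dn.
rewrite -natrX -(@count_rot_fixed E d) // mulnC divnK //.
by rewrite -sum1_count natr_sum [RHS]big_mkcond; apply: eq_bigr => w _; case: ifP.
Qed.

End Words.

Section LyndonCount.
Local Open Scope ring_scope.
Variables (disp : Order.disp_t) (X : orderType disp).
Implicit Types (E w u v : seq X).

(** Let [w = a ++ b] be smaller than its rotations. If [b < w] for a proper suffix
    [b], then [w < b ++ a] forces [w = b ++ s] with [s < a], and the rotation
    [s ++ b] is smaller than [w]. *)
Lemma lyndon_rotP w : reflect
  (w != [::] /\ forall k, (0 < k < size w)%N -> (w < rot k w)%O) (lyndon w).
Proof.
apply: (iffP (lyndonP w)) => -[w0 H]; split=> //.
  move=> k /andP[k0 kw]; rewrite /rot.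
  have wlt : (w < drop k w)%O.
    apply: (H (take k w)); last by rewrite cat_take_drop.
      by rewrite -size_eq0 size_takel ?(ltnW kw) // -lt0n.
    by rewrite -size_eq0 size_drop subn_eq0 -ltnNge.
  apply: lt_trans wlt (ltxi_catl _ _).
  by rewrite -size_eq0 size_takel ?(ltnW kw) // -lt0n.
move=> a b a0 b0 wE; have sa : (0 < size a)%N by rewrite lt0n size_eq0.
have sb : (0 < size b)%N by rewrite lt0n size_eq0.
have wba : (w < b ++ a)%O.
  by have := H (size a); rewrite wE rot_size_cat size_cat; apply; lia.
rewrite ltNge le_eqVlt; apply/negP => /orP[/eqP bw|bw].
  by have := congr1 size bw; rewrite wE size_cat; lia.
have [[s s0 wbs]|/(_ a [::])] := ltxiP bw; last first.
  by rewrite cats0 ltNge (ltW wba).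
have ss : size s = size a.
  by apply/eqP; rewrite -(eqn_add2l (size b)) -size_cat -wbs wE size_cat addnC.
have wsb : (w < s ++ b)%O.
  by have := H (size b); rewrite wbs rot_size_cat size_cat ss; apply; lia.
have sa' : (s < a)%O by rewrite -(ltxi_cat2l b) -wbs.
have := lt_trans wsb (ltxi_cat_size b b ss sa').
by rewrite -wE ltxx.
Qed.

Lemma lyndon_primitive w : lyndon w -> primitive w.
Proof.
case/lyndon_rotP => _ H; apply/primitiveP => k /H.
by rewrite lt_neqAle eq_sym => /andP[].
Qed.

Lemma lyndon_rot_inj w j k : (j < size w)%N -> (k < size w)%N ->
  lyndon (rot j w) -> lyndon (rot k w) -> j = k.
Proof.
wlog jk : j k / (j < k)%N => [H jw kw lj lk|jw kw lj lk].
  by have [jk|kj|//] := ltngtP j k; [|apply/esym]; apply: H.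
have kE : rot k w = rot (k - j) (rot j w) by rewrite -rotD subnK // ltnW.
have jE : rot j w = rot (size w - (k - j)) (rot k w).
  have kjw : (k - j <= size w)%N by lia.
  by rewrite kE -rotD ?size_rot subnK // [RHS]rot_oversize ?size_rot.
have [_ Hj] := lyndon_rotP _ lj; have [_ Hk] := lyndon_rotP _ lk.
rewrite size_rot in Hj; rewrite size_rot in Hk.
have jk' : (rot j w < rot k w)%O by rewrite {1}kE Hj //; lia.
have : (rot k w < rot j w)%O by rewrite {1}jE Hk //; lia.
by rewrite ltNge ltW.
Qed.

(** The smallest rotation: primitivity makes it strictly smaller than the
    others. *)
Lemma primitive_lyndon_rot w : w != [::] -> primitive w ->
  exists2 k, (k < size w)%N & lyndon (rot k w).
Proof.
move=> w0 pw; have sw : (0 < size w)%N by rewrite lt0n size_eq0.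
pose k := [arg min_(k < Ordinal sw) rot k w]%O.
have kmin (j : 'I_(size w)) : (rot k w <= rot j w)%O.
  by rewrite /k; case: arg_minP => // i _; apply.
exists k; first exact: ltn_ord.
apply/lyndon_rotP; split; first by rewrite -size_eq0 size_rot size_eq0.
rewrite size_rot => j jw; rewrite lt_neqAle; apply/andP; split.
  by rewrite eq_sym rot_rot (inj_eq (@rot_inj k _)) (primitiveP _ pw).
have [i iw ->] : exists2 i, (i < size w)%N & rot j (rot k w) = rot i w.
  have kw := ltn_ord k; rewrite rot_add_mod; try lia.
  case: ifP => jk; last by exists (j + k - size w)%N => //; lia.
  have [jkw|jkw] := ltnP (j + k) (size w); first by exists (j + k)%N.
  by exists 0%N => //; rewrite rot0 rot_oversize.
exact: (kmin (Ordinal iw)).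
Qed.

Lemma sum_lyndon_rot w : (0 < size w)%N ->
  (\sum_(k < size w) lyndon (rot k w) = primitive w)%N.
Proof.
move=> w0; have [pw|npw] := boolP (primitive w); last first.
  rewrite big1 // => k _; apply/eqP; rewrite eqb0; apply: contra npw.
  move=> /lyndon_primitive /primitiveP H; apply/primitiveP => j jw.
  by have := H j; rewrite size_rot rot_rot (inj_eq (@rot_inj k _)); apply.
have [|k kw lk] := primitive_lyndon_rot _ pw; first by rewrite -size_eq0 -lt0n.
rewrite (bigD1 (Ordinal kw)) //= lk big1 ?addn0 // => j jk.
apply/eqP; rewrite eqb0; apply: contra jk => lj; apply/eqP/val_inj.
exact: lyndon_rot_inj lj lk.
Qed.

(** Sum over the words and over the rotation amounts [k < n]: a primitive word has
    exactly one Lyndon rotation, and [rot k] permutes the words of length [n]. *)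
Lemma count_primitive_lyndon E n : uniq E -> (0 < n)%N ->
  count (@primitive X) (words E n) = (n * count (@lyndon _ X) (words E n))%N.
Proof.
move=> uE n0; rewrite -!sum1_count big_mkcond.
rewrite (eq_big_seq (fun w => \sum_(k < n) lyndon (rot k w)))%N => [|w]; last first.
  rewrite mem_words => /andP[/eqP wn _]; by rewrite -wn sum_lyndon_rot ?wn.
rewrite exchange_big /= (_ : n * _ = \sum_(k < n) \sum_(w <- words E n | lyndon w) 1)%N;
  last by rewrite sum_nat_const card_ord.
apply: eq_bigr => k _; rewrite [RHS]big_mkcond /=.
have rot_words : perm_eq (map (rot k) (words E n)) (words E n).
  apply: uniq_perm; rewrite ?words_uniq //.
    by rewrite map_inj_uniq ?words_uniq //; apply: rot_inj.
  move=> w; apply/mapP/idP => [[v vE ->]|wE].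
    by move: vE; rewrite !mem_words size_rot (eq_all_r (mem_rot k v)).
  exists (rotr k w); last by rewrite rotrK.
  by move: wE; rewrite !mem_words size_rotr (eq_all_r (mem_rotr k w)).
rewrite -[RHS](perm_big _ rot_words) big_map; apply: eq_bigr => w _.
by case: (lyndon _).
Qed.

Lemma necklace_count_lyndon E n : uniq E -> (0 < n)%N ->
  necklace (Some (size E)) n = Some (count (@lyndon _ X) (words E n))%:R.
Proof.
move=> uE n0; rewrite /necklace /=; congr Some.
have n_neq0 : n%:R != 0 :> rat by rewrite pnatr_eq0 -lt0n.
apply: (mulfI n_neq0); rewrite mulVKf // -natrM -count_primitive_lyndon //.
rewrite -[RHS](rmorph_nat (intr : int -> rat)) count_primitive // rmorph_sum.
by apply: eq_bigr => d _; rewrite rmorphM rmorphXn /= !rmorph_nat.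
Qed.

End LyndonCount.

(** * The free Lie ring *)

Section Span.
Local Open Scope classical_set_scope.
Local Open Scope ring_scope.
Variable V : zmodType.
Implicit Types (S T : set V) (M : {pred V}).

Lemma mem_zspan S v : S v -> v \in zspan S.
Proof. by move=> Sv; apply/asboolP => M _; apply. Qed.

Lemma zspan_min S M : zmod_closed M -> (forall s, S s -> s \in M) ->
  forall v, v \in zspan S -> v \in M.
Proof. by move=> cM SM v /asboolP; apply. Qed.

Lemma zspan_ind S (P : V -> Prop) : P 0 ->
  (forall u v, P u -> P v -> P (u - v)) -> (forall s, S s -> P s) ->
  forall v, v \in zspan S -> P v.
Proof.
move=> P0 PB PS v /asboolP /(_ (fun v => `[< P v >])) H; apply/asboolP/H.
  by split=> [|a b /asboolP Pa /asboolP Pb]; apply/asboolP; [|apply: PB].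
by move=> s Ss; apply/asboolP/PS.
Qed.

Lemma zspanS S T : S `<=` T -> {subset zspan S <= zspan T}.
Proof.
by move=> ST; apply: zspan_min (zspan_zmod T) _ => s /ST; apply: mem_zspan.
Qed.

End Span.

Section LieBracket.
Local Open Scope classical_set_scope.
Local Open Scope ring_scope.
Variable R : pzRingType.
Implicit Types p q r : R.

Definition lie_bracket p q : R := p * q - q * p.

Lemma lie_bracketBl p p' q :
  lie_bracket (p - p') q = lie_bracket p q - lie_bracket p' q.
Proof. by rewrite /lie_bracket mulrBl mulrBr !opprB (AC (2*2) ((1*4)*(3*2))). Qed.

Lemma lie_bracketC p q : lie_bracket p q = - lie_bracket q p.
Proof. by rewrite /lie_bracket opprB. Qed.

Lemma lie_bracketBr p q q' :
  lie_bracket p (q - q') = lie_bracket p q - lie_bracket p q'.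
Proof. by rewrite !(lie_bracketC p) lie_bracketBl opprB opprK addrC. Qed.

Lemma lie_bracket0l q : lie_bracket 0 q = 0.
Proof. by rewrite /lie_bracket mul0r mulr0 subrr. Qed.

Lemma lie_bracket0r q : lie_bracket q 0 = 0.
Proof. by rewrite /lie_bracket mul0r mulr0 subrr. Qed.

Lemma lie_bracketxx p : lie_bracket p p = 0.
Proof. exact: subrr. Qed.

Lemma lie_jacobi p q r : lie_bracket p (lie_bracket q r) =
  lie_bracket (lie_bracket p q) r - lie_bracket (lie_bracket p r) q.
Proof.
rewrite /lie_bracket !mulrBl !mulrBr !mulrA !opprB.
rewrite [RHS](AC ((2*2)*(2*2)) (((1*8)*(3*6))*((2*5)*(7*4)))) /=.
by rewrite addNr subrr !addr0.
Qed.

End LieBracket.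

Section WordFunctions.
Local Open Scope classical_set_scope.
Local Open Scope ring_scope.
Variable X : choiceType.
Implicit Types (P Q : wordfun X) (a b t u v w : seq X) (x y : X).

Lemma wordfunM P Q w :
  (P * Q) w = \sum_(i < (size w).+1) P (take i w) * Q (drop i w).
Proof. by []. Qed.

Lemma wordfunB P Q w : (P - Q) w = P w - Q w.
Proof. by []. Qed.

Lemma wordfunM_supp P Q w : (P * Q) w != 0 ->
  exists a b, [/\ w = a ++ b, P a != 0 & Q b != 0].
Proof.
move=> PQ; have [|/forallNP H] := pselect (exists i, P (take i w) * Q (drop i w) != 0).
  case=> i; rewrite mulf_eq0 negb_or => /andP[Pa Qb].
  by exists (take i w), (drop i w); rewrite cat_take_drop.
by move: PQ; rewrite wordfunM big1 ?eqxx // => i _; apply/eqP/negPn/negP/H.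
Qed.

Lemma wordfunM_cat P Q u v : (forall a, P a != 0 -> size a = size u) ->
  (P * Q) (u ++ v) = P u * Q v.
Proof.
move=> Pu; have iu : (size u < (size (u ++ v)).+1)%N by rewrite size_cat ltnS leq_addr.
rewrite wordfunM (bigD1 (Ordinal iu)) //= take_size_cat // drop_size_cat //.
rewrite big1 ?addr0 // => i iNu.
have [P0|/Pu] := eqVneq (P (take i (u ++ v))) 0; first by rewrite P0 mul0r.
rewrite size_takel; last by rewrite -ltnS.
by move=> iE; case/eqP: iNu; apply: val_inj.
Qed.

Definition homogeneous (n : nat) P := forall w, P w != 0 -> size w = n.

Lemma homogeneousB n P Q : homogeneous n P -> homogeneous n Q -> homogeneous n (P - Q).
Proof.
move=> hP hQ w; have [P0|/hP //] := eqVneq (P w) 0.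
rewrite wordfunB P0 sub0r oppr_eq0; exact: hQ.
Qed.

Lemma homogeneousM m n P Q :
  homogeneous m P -> homogeneous n Q -> homogeneous (m + n) (P * Q).
Proof.
by move=> hP hQ w /wordfunM_supp[a [b [-> /hP <- /hQ <-]]]; rewrite size_cat.
Qed.

Lemma homogeneous_bracket m n P Q :
  homogeneous m P -> homogeneous n Q -> homogeneous (m + n) (lie_bracket P Q).
Proof.
move=> hP hQ; apply: homogeneousB; first exact: homogeneousM.
by rewrite addnC; apply: homogeneousM.
Qed.

Definition left_bracket w : wordfun X :=
  if w is x :: w' then foldl (fun P y => lie_bracket P (ncX_fun y)) (ncX_fun x) w'
  else 0.

(** The degree [n] part of the free Lie ring on [X], inside the free associative
    ring; the left-normed brackets of letters span it by the Jacobi identity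
    ([lie_bracket_lie]). *)
Definition lie n : {pred wordfun X} :=
  zspan [set P | exists2 w, size w = n & P = left_bracket w].

Lemma left_bracket_rcons w x : w != [::] ->
  left_bracket (rcons w x) = lie_bracket (left_bracket w) (ncX_fun x).
Proof. by case: w => // y w _; rewrite /= foldl_rcons. Qed.

Lemma ncX_homogeneous x : homogeneous 1 (ncX_fun x).
Proof. by move=> w; rewrite /ncX_fun; case: (w =P [:: x]) => [->|_]; rewrite ?eqxx. Qed.

Lemma left_bracket_homogeneous w : homogeneous (size w) (left_bracket w).
Proof.
elim/last_ind: w => [|w x IH]; first by move=> w; rewrite eqxx.
have [->|w0] := eqVneq w [::]; first exact: ncX_homogeneous.
rewrite left_bracket_rcons // size_rcons -addn1.
by apply: homogeneous_bracket IH _; apply: ncX_homogeneous.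
Qed.

Lemma lie_homogeneous n P : P \in lie n -> homogeneous n P.
Proof.
apply: zspan_ind => [w|Q Q' hQ hQ'|_ [w <- ->]]; first by rewrite eqxx.
  exact: homogeneousB.
exact: left_bracket_homogeneous.
Qed.

Lemma left_bracket_lie w : left_bracket w \in lie (size w).
Proof. by apply: mem_zspan; exists w. Qed.

Lemma lie_bracket_letter n P x : P \in lie n -> lie_bracket P (ncX_fun x) \in lie n.+1.
Proof.
move: P; apply: zspan_ind => [|Q Q' hQ hQ'|_ [w <- ->]].
- by rewrite lie_bracket0l rpred0.
- by rewrite lie_bracketBl rpredB.
have [->|w0] := eqVneq w [::]; first by rewrite lie_bracket0l rpred0.
by rewrite -left_bracket_rcons // -(size_rcons w x) left_bracket_lie.
Qed.

(** Induction on the second factor, since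
    [[P, [Q, x]] = [[P, Q], x] - [[P, x], Q]]. *)
Lemma lie_bracket_lie m n P Q :
  P \in lie m -> Q \in lie n -> lie_bracket P Q \in lie (m + n).
Proof.
move=> lP lQ; move: Q lQ m P lP; apply: zspan_ind.
- by move=> m P _; rewrite lie_bracket0r rpred0.
- by move=> Q Q' IQ IQ' m P lP; rewrite lie_bracketBr rpredB ?IQ ?IQ'.
move=> _ [w <- ->]; elim/last_ind: w => [|w x IH] m P lP.
  by rewrite lie_bracket0r rpred0.
have [->|w0] := eqVneq w [::]; first by rewrite addn1; apply: lie_bracket_letter.
rewrite left_bracket_rcons // lie_jacobi size_rcons addnS rpredB //.
  by apply/lie_bracket_letter/IH.
by rewrite -addSn; apply/IH/lie_bracket_letter.
Qed.

End WordFunctions.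

(** * The Lyndon basis of the free Lie ring *)

(** A strict order is well founded on a finite set: count the smaller elements. *)
Lemma finite_order_ind (T : eqType) (lt : rel T) (s : seq T) (p : T -> Prop) :
  irreflexive lt -> transitive lt ->
  (forall x, x \in s -> (forall y, y \in s -> lt y x -> p y) -> p x) ->
  forall x, x \in s -> p x.
Proof.
move=> lt_irr lt_tr Hp x; have [k] := ubnP (count (lt^~ x) s).
elim: k x => // k IH x xk xs; apply: Hp xs _ => y ys yx; apply: IH (ys).
rewrite ltnS in xk; apply: leq_trans xk.
have y1 : (0 < count (pred1 y) s)%N by rewrite -has_count has_pred1.
rewrite -addn1; apply: leq_trans (leq_add (leqnn _) y1) _.
rewrite -count_predUI [X in (_ + X)%N](@eq_count _ _ pred0) => [|z].
  rewrite count_pred0 addn0; apply: sub_count => z /= /orP[/lt_tr|/eqP ->//].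
  exact.
by apply/negP => /andP[zy /eqP zE]; rewrite zE lt_irr in zy.
Qed.

Section LyndonBasis.
Local Open Scope classical_set_scope.
Local Open Scope ring_scope.
Variables (d : Order.disp_t) (X : orderType d).
Implicit Types (P Q : wordfun X) (a b t u v w : seq X) (x y : X).

(** Bracketing along standard factorizations. The number [k] bounds the depth of
    the recursion, for which [size w] is always enough ([lyndon_poly_rec_size]). *)
Fixpoint lyndon_poly_rec (k : nat) w : wordfun X :=
  match k, w with
  | k'.+1, [:: x] => ncX_fun x
  | k'.+1, _ => let v := min_suffix (behead w) in
     lie_bracket (lyndon_poly_rec k' (take (size w - size v) w)) (lyndon_poly_rec k' v)
  | 0, _ => 0
  end.

Definition lyndon_poly w := lyndon_poly_rec (size w) w.

Lemma lyndon_poly1 x : lyndon_poly [:: x] = ncX_fun x.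
Proof. by []. Qed.

Lemma lyndon_poly_rec_cat k u v : standard u v ->
  lyndon_poly_rec k.+1 (u ++ v) =
  lie_bracket (lyndon_poly_rec k u) (lyndon_poly_rec k v).
Proof.
move=> suv; have [lu lv _ _] := suv.
have [u0 v0] := (lyndon_neq0 lu, lyndon_neq0 lv).
have := standard_min_suffix suv.
case uvE: (u ++ v) => [|x [|y w]].
- by case: (u) u0 uvE.
- case: (u) u0 uvE => // z [|z' u'] _ //=; by case: (v) v0.
rewrite -[behead _]/(y :: w) => vE.
rewrite -[LHS]/(lie_bracket
  (lyndon_poly_rec k (take (size [:: x, y & w] - size (min_suffix (y :: w))) [:: x, y & w]))
  (lyndon_poly_rec k (min_suffix (y :: w)))).
by rewrite vE -uvE size_cat addnK take_size_cat.
Qed.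

Lemma lyndon_ind (p : seq X -> Prop) : (forall x, p [:: x]) ->
  (forall u v, standard u v -> p u -> p v -> p (u ++ v)) ->
  forall w, lyndon w -> p w.
Proof.
move=> p1 pcat w; have [k] := ubnP (size w); elim: k w => // k IH w wk lw.
have [w1|w1] := ltnP 1 (size w); last first.
  by have := lyndon_neq0 lw; case: w w1 {wk lw} => [|x [|//]] // _ _; apply: p1.
have [u [v [wE suv]]] := standard_factorization lw w1; have [lu lv _ _] := suv.
have [u0 v0] := (lyndon_neq0 lu, lyndon_neq0 lv).
rewrite wE in wk *; move: wk; rewrite size_cat ltnS => wk.
apply: pcat suv _ _; apply: IH => //; apply: leq_trans wk.
  by rewrite -[ltnLHS]addn0 ltn_add2l lt0n size_eq0.
by rewrite -[ltnLHS]add0n ltn_add2r lt0n size_eq0.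
Qed.

Lemma lyndon_poly_rec_size k w : lyndon w -> (size w <= k)%N ->
  lyndon_poly_rec k w = lyndon_poly w.
Proof.
move=> lw; elim/lyndon_ind: w / lw k => [x [|k] //|u v suv IHu IHv k].
have [lu lv _ _] := suv; have [u0 v0] := (lyndon_neq0 lu, lyndon_neq0 lv).
have u1 : (0 < size u)%N by rewrite lt0n size_eq0.
have v1 : (0 < size v)%N by rewrite lt0n size_eq0.
rewrite /lyndon_poly size_cat; case: k => [|k] uvk; first lia.
have -> : (size u + size v = (size u + size v).-1.+1)%N by lia.
rewrite !lyndon_poly_rec_cat //; congr lie_bracket.
  by rewrite !IHu //; lia.
by rewrite !IHv //; lia.
Qed.

Lemma lyndon_poly_cat u v : standard u v ->
  lyndon_poly (u ++ v) = lie_bracket (lyndon_poly u) (lyndon_poly v).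
Proof.
move=> suv; have [lu lv _ _] := suv.
rewrite -(@lyndon_poly_rec_size (size (u ++ v)).+1) ?standard_cat //.
by rewrite lyndon_poly_rec_cat // !lyndon_poly_rec_size // size_cat ?leq_addr ?leq_addl.
Qed.

Lemma lyndon_poly_lie w : lyndon w -> lyndon_poly w \in lie (size w).
Proof.
elim/lyndon_ind => [x|u v suv IHu IHv]; first exact: (left_bracket_lie [:: x]).
by rewrite lyndon_poly_cat // size_cat lie_bracket_lie.
Qed.

Definition triangular w P :=
  P w = 1 /\ forall t, P t != 0 -> perm_eq t w /\ (w <= t)%O.

Lemma triangularM u v P Q : triangular u P -> triangular v Q ->
  triangular (u ++ v) (P * Q).
Proof.
move=> [Pu Ptri] [Qv Qtri]; split.
  by rewrite wordfunM_cat ?Pu ?Qv ?mulr1 // => a /Ptri[/perm_size].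
move=> _ /wordfunM_supp[a [b [-> /Ptri[au ua] /Qtri[bv vb]]]].
split; first exact: perm_cat.
by apply: lexi_cat_size => //; rewrite (perm_size au).
Qed.

(** Write [P_w] for [lyndon_poly w]. In [P_(u ++ v) = P_u * P_v - P_v * P_u] the
    second product does not disturb the leading word of the first, because
    [u ++ v < v ++ u]. *)
Lemma lyndon_poly_triangular w : lyndon w -> triangular w (lyndon_poly w).
Proof.
elim/lyndon_ind => [x|u v suv IHu IHv].
  rewrite lyndon_poly1 /ncX_fun; split; first by rewrite eqxx.
  by move=> t; case: (t =P [:: x]) => [->|_] //; rewrite eqxx.
have [lu lv uv _] := suv; rewrite lyndon_poly_cat //.
have [PQ1 PQtri] := triangularM IHu IHv; have [_ QPtri] := triangularM IHv IHu.
have uvvu : (u ++ v < v ++ u)%O.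
  by apply: lt_trans (lyndon_cat_lt lu lv uv) (ltxi_catl _ (lyndon_neq0 lu)).
split.
  rewrite /lie_bracket wordfunB PQ1.
  have [->|/QPtri[_]] := eqVneq ((lyndon_poly v * lyndon_poly u) (u ++ v)) 0.
    by rewrite subr0.
  by rewrite leNgt uvvu.
move=> t; rewrite /lie_bracket wordfunB.
have [->|/PQtri //] := eqVneq ((lyndon_poly u * lyndon_poly v) t) 0.
rewrite sub0r oppr_eq0 => /QPtri[tvu vut].
split; last exact: le_trans (ltW uvvu) vut.
by apply: (perm_trans tvu); rewrite perm_catC.
Qed.

Definition lyndon_polys (n : nat) (A : pred (seq X)) : set (wordfun X) :=
  [set P | exists w, [/\ lyndon w, size w = n, A w & P = lyndon_poly w]].

(** Induction on the total length, then on the larger word [v], which ranges over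
    the finite set of words of bounded length with letters in [s]. Write [P_w]
    for [lyndon_poly w]. If [(u, v)] is not standard, then [u = u1 ++ u2] with
    [u1 < u2 < v], and by the Jacobi identity
    [[P_u, P_v] = [P_u1, [P_u2, P_v]] - [P_u2, [P_u1, P_v]]]. The inner brackets
    are shorter, hence combinations of Lyndon words below [v], so that only words
    below [v] occur in the outer brackets. This descent is the reason for keeping
    track of [w < v]. *)
Lemma bracket_lyndon_poly_bound (s : seq X) u v :
  lyndon u -> lyndon v -> (u < v)%O -> all (mem s) u -> all (mem s) v ->
  lie_bracket (lyndon_poly u) (lyndon_poly v) \in
    zspan (lyndon_polys (size u + size v) (fun w => (w < v)%O && all (mem s) w)).
Proof.
have [n] := ubnP (size u + size v).
elim: n u v => // n IHn u v uvn lu lv uv su sv.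
pose short_words := flatten [seq words s k | k <- iota 0 n.+1].
have mem_short w : (size w < n.+1)%N -> all (mem s) w -> w \in short_words.
  move=> wn ws; apply/flatten_mapP; exists (size w); first by rewrite mem_iota.
  by rewrite mem_words eqxx.
have vs : v \in short_words.
  by apply: mem_short sv; apply: leq_ltn_trans uvn; apply: leq_addl.
move: v vs u uvn lu lv uv su sv.
apply: (@finite_order_ind _ (fun u v => (u < v)%O)) => [w|v u w|v vs IHv u uvn lu lv uv su sv].
- exact: ltxx.
- exact: lt_trans.
(* the induction on the larger word, whichever of the two factors that is *)
have IHv' k a P : lyndon a -> all (mem s) a -> (a < v)%O -> (size a + k = size u + size v)%N ->
    P \in zspan (lyndon_polys k (fun w => (w < v)%O && all (mem s) w)) ->
    lie_bracket (lyndon_poly a) P \in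
      zspan (lyndon_polys (size u + size v) (fun w => (w < v)%O && all (mem s) w)).
  move=> la sa av ak; move: P; apply: zspan_ind => [|P Q hP hQ|_ [b [lb bk /andP[bv sb] ->]]].
  - by rewrite lie_bracket0r rpred0.
  - by rewrite lie_bracketBr rpredB.
  have mono c : (c < v)%O ->
     {subset zspan (lyndon_polys (size u + size v) (fun w => (w < c)%O && all (mem s) w)) <=
        zspan (lyndon_polys (size u + size v) (fun w => (w < v)%O && all (mem s) w))}.
    move=> cv; apply: zspanS => _ [w [lw wk /andP[wc sw] ->]].
    by exists w; split; rewrite // (lt_trans wc cv).
  have [ab|ba|->] := ltgtP a b; last by rewrite lie_bracketxx rpred0.
    apply: (mono b) => //; rewrite -ak -bk; apply: IHv => //; last by rewrite bk ak.
    by apply: mem_short; rewrite // bk; apply: leq_ltn_trans uvn; rewrite -ak leq_addl.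
  rewrite lie_bracketC rpredN; apply: (mono a) => //.
  rewrite -ak -bk addnC; apply: IHv => //; last by rewrite bk addnC ak.
  by apply: mem_short; rewrite //; apply: leq_ltn_trans uvn; rewrite -ak leq_addr.
have [suv|[u1 [u2 [uE std u2v]]]] := standard_or lu lv uv.
  rewrite -lyndon_poly_cat //; apply: mem_zspan; exists (u ++ v).
  by rewrite standard_cat // size_cat all_cat su sv lyndon_cat_lt.
have [lu1 lu2 u12 _] := std.
have u11 : (0 < size u1)%N by rewrite lt0n size_eq0 lyndon_neq0.
have u21 : (0 < size u2)%N by rewrite lt0n size_eq0 lyndon_neq0.
have u1v := lt_trans u12 u2v.
move: su; rewrite uE all_cat => /andP[su1 su2].
rewrite uE size_cat in uvn IHv' *.
have -> : lie_bracket (lyndon_poly (u1 ++ u2)) (lyndon_poly v) =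
    lie_bracket (lyndon_poly u1) (lie_bracket (lyndon_poly u2) (lyndon_poly v)) -
    lie_bracket (lyndon_poly u2) (lie_bracket (lyndon_poly u1) (lyndon_poly v)).
  by rewrite lyndon_poly_cat // lie_jacobi (lie_bracketC (lyndon_poly u2) (lie_bracket _ _)) opprK subrK.
rewrite ltnS in uvn.
have u2n : (size u2 + size v < n)%N.
  by apply: leq_trans uvn; rewrite -addnA -[ltnLHS]add0n ltn_add2r.
have u1n : (size u1 + size v < n)%N.
  by apply: leq_trans uvn; rewrite ltn_add2r -[ltnLHS]addn0 ltn_add2l.
apply: rpredB.
  apply: (IHv' (size u2 + size v)%N u1) (IHn _ _ u2n lu2 lv u2v su2 sv) => //.
  by rewrite addnA.
apply: (IHv' (size u1 + size v)%N u2) (IHn _ _ u1n lu1 lv u1v su1 sv) => //.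
by rewrite addnCA addnA.
Qed.

Lemma lie_lyndon_span n P : P \in lie n ->
  P \in zspan (lyndon_polys n predT).
Proof.
move: P; apply: zspan_ind => [|P Q hP hQ|_ [w <- ->]]; first exact: rpred0.
  exact: rpredB.
elim/last_ind: w => [|w x IH]; first exact: rpred0.
have [->|w0] := eqVneq w [::].
  by apply: mem_zspan; exists [:: x]; rewrite lyndon_poly1.
rewrite left_bracket_rcons // size_rcons; move: (left_bracket w) IH.
apply: zspan_ind => [|P Q hP hQ|_ [v [lv vw _ ->]]].
- by rewrite lie_bracket0l rpred0.
- by rewrite lie_bracketBl rpredB.
have mem_s : all (mem (x :: v)) [:: x] /\ all (mem (x :: v)) v.
  by split; apply/allP => y /= ys; rewrite inE ?ys ?orbT //; rewrite inE in ys; rewrite ys.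
have sub (a : pred (seq X)) (N : nat) : N = (size w).+1 ->
    {subset zspan (lyndon_polys N a) <= zspan (lyndon_polys (size w).+1 predT)}.
  by move=> ->; apply: zspanS => _ [t [? ? _ ->]]; exists t.
rewrite -[ncX_fun x]lyndon_poly1; have [vx|xv|->] := ltgtP v [:: x]; last first.
- by rewrite lie_bracketxx rpred0.
- rewrite lie_bracketC rpredN; apply: (sub (fun w => (w < v)%O && all (mem (x :: v)) w) (size [:: x] + size v)%N).
    by rewrite vw.
  by apply: bracket_lyndon_poly_bound; rewrite ?lyndon1 //; case: mem_s.
apply: (sub (fun w => (w < [:: x])%O && all (mem (x :: v)) w) (size v + size [:: x])%N).
  by rewrite vw addn1.
by apply: bracket_lyndon_poly_bound; rewrite ?lyndon1 //; case: mem_s.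
Qed.

End LyndonBasis.

(** * Leading parts of Magnus expansions *)

Section LeadingParts.
Local Open Scope classical_set_scope.
Local Open Scope ring_scope.
Variable X : choiceType.
Implicit Types (P Q : wordfun X) (w : seq X) (x : X) (f : ncseries X) (g h a b r : freegroup X).

Lemma magnus_nil g : nccoef (magnus g) [::] = 1.
Proof. by apply/eqP; rewrite -subr_eq0; apply/eqP/(@magnus_order1 _ g). Qed.

Lemma nccoef_magnusM_order n g f w :
  order_ge n f -> size w = n -> nccoef (magnus g * f) w = nccoef f w.
Proof.
move=> nf wn; move: wn nf => <- nf; rewrite nccoefM big_ord_recl take0 drop0 magnus_nil mul1r.
rewrite big1 ?addr0 // => i _; rewrite nf ?mulr0 //.
by have := ltn_ord i; rewrite size_drop lift0; lia.
Qed.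

Lemma nccoef_magnusM_lcs n g r w : (0 < n)%N -> lcs n r -> size w = n ->
  nccoef (magnus (g * r)%g) w = nccoef (magnus g) w + nccoef (magnus r) w.
Proof.
move=> n0 /magnus_lcs nr wn; rewrite magnusM -[magnus r](subrK 1) mulrDr mulr1 nccoefD.
rewrite (nccoef_magnusM_order _ nr wn) addrC subrK nccoefB nccoef1.
by rewrite -size_eq0 wn eqn0Ngt n0 subr0.
Qed.

Lemma nccoef_magnusV_lcs n r w : (0 < n)%N -> lcs n r -> size w = n ->
  nccoef (magnus r^-1%g) w = - nccoef (magnus r) w.
Proof.
move=> n0 rn wn; have := nccoef_magnusM_lcs r^-1%g n0 rn wn.
rewrite mulVg magnus1 nccoef1 -size_eq0 wn eqn0Ngt n0 => /esym/eqP.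
by rewrite addr_eq0 => /eqP.
Qed.

Definition leading_part n r P := forall w, size w = n -> nccoef (magnus r) w = P w.

Lemma nccoefM_leading m n f f' P Q w : order_ge m f -> order_ge n f' ->
  homogeneous m P -> homogeneous n Q ->
  (forall u, size u = m -> nccoef f u = P u) ->
  (forall u, size u = n -> nccoef f' u = Q u) ->
  size w = (m + n)%N -> nccoef (f * f') w = (P * Q) w.
Proof.
move=> mf nf' hP hQ fP f'Q wmn; rewrite nccoefM wordfunM; apply: eq_bigr => -[i /= i_lt] _.
have iw : (i <= size w)%N by [].
have st : size (take i w) = i by rewrite size_takel.
have sd : size (drop i w) = (m + n - i)%N by rewrite size_drop wmn.
have [im|mi|im] := ltngtP i m.
- rewrite mf ?st // mul0r; have [->|/hP] := eqVneq (P (take i w)) 0; first by rewrite mul0r.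
  by rewrite st => iE; rewrite iE ltnn in im.
- rewrite nf' ?sd ?mulr0; last lia.
  have [->|/hQ] := eqVneq (Q (drop i w)) 0; first by rewrite mulr0.
  by rewrite sd; lia.
by rewrite fP ?st // f'Q // sd im addKn.
Qed.

(** As the factor [magnus (a^-1 * b^-1)] has constant term 1, group commutators
    become Lie brackets in the lowest degree. *)
Lemma magnus_commutator a b : magnus [~ a, b]%g =
  1 + magnus (a^-1 * b^-1)%g * lie_bracket (magnus a - 1) (magnus b - 1).
Proof.
have br1 (p : ncseries X) : lie_bracket p 1 = 0 by rewrite /lie_bracket mulr1 mul1r subrr.
rewrite lie_bracketBl !lie_bracketBr br1 (lie_bracketC 1) !br1 !subr0 oppr0 subr0.
rewrite /lie_bracket mulrBr -!magnusM.
have -> : (a^-1 * b^-1 * (b * a) = 1)%g by rewrite -mulgA mulKg mulVg.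
have -> : (a^-1 * b^-1 * (a * b) = [~ a, b])%g by rewrite commgEl conjgE !mulgA.
by rewrite magnus1 addrC subrK.
Qed.

Lemma leading_part_commutator n a b P Q : (0 < n)%N -> lcs n a ->
  homogeneous n P -> homogeneous 1 Q -> leading_part n a P -> leading_part 1 b Q ->
  leading_part n.+1 [~ a, b]%g (lie_bracket P Q).
Proof.
move=> n0 /magnus_lcs oa hP hQ aP bQ w wn.
have ob := magnus_order1 b.
have oab : order_ge n.+1 (lie_bracket (magnus a - 1) (magnus b - 1)).
  apply: order_geD; first by rewrite -addn1; apply: order_geM.
  by apply: order_geN; rewrite -add1n; apply: order_geM.
have lead m g R : leading_part m g R -> (0 < m)%N ->
    forall u, size u = m -> nccoef (magnus g - 1) u = R u.
  move=> gR m0 u um; rewrite nccoefB gR // nccoef1.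
  by rewrite -size_eq0 um eqn0Ngt m0 subr0.
rewrite magnus_commutator nccoefD nccoef1 (nccoef_magnusM_order _ oab) //.
rewrite -size_eq0 wn add0r /lie_bracket nccoefB wordfunB; congr (_ - _).
  by apply: (nccoefM_leading oa ob hP hQ); rewrite ?addn1 //; apply: lead.
by apply: (nccoefM_leading ob oa hQ hP); rewrite ?add1n //; apply: lead.
Qed.

Lemma leading_part1 g : exists2 P, P \in lie 1 & leading_part 1 g P.
Proof.
rewrite /leading_part /magnus; elim: (fg_word g) => [|a s [P lP sP]].
  exists 0; first exact: rpred0.
  by move=> w w1; rewrite big_nil nccoef1; case: w w1.
have [Q lQ aQ] : exists2 Q, Q \in lie 1 &
    forall y, nccoef (magnus_letter a) [:: y] = Q [:: y].
  have lx : @ncX_fun X a.1 \in lie 1 by exact: (left_bracket_lie [:: a.1]).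
  case: a lx => x [] lx.
    by exists (ncX_fun x) => // y; rewrite nccoefD nccoef1 add0r.
  exists (- ncX_fun x) => [|y]; first by rewrite rpredN.
  rewrite /nccoef /= /inv1X_fun /= andbT -[RHS]/(- ncX_fun x [:: y]) /ncX_fun eqseq_cons andbT.
  by case: (y == x); rewrite ?oppr0.
exists (Q + P); first exact: rpredD.
case=> [|y [|//]] // _; rewrite big_cons nccoefM big_ord_recl big_ord1 /= aQ sP //.
have -> : nccoef (magnus_letter a) [::] = 1 by case: (a) => x [].
have -> : nccoef (\prod_(b <- s) magnus_letter b) [::] = 1.
  elim: s {sP} => [|b s IH]; first by rewrite big_nil.
  by rewrite big_cons nccoefM big_ord1 IH mulr1; case: (b) => x [].
by rewrite mul1r mulr1 addrC.
Qed.

Lemma leading_partB n r s P Q : (0 < n)%N -> lcs n r -> lcs n s ->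
  leading_part n r P -> leading_part n s Q -> leading_part n (r * s^-1)%g (P - Q).
Proof.
move=> n0 nr ns rP sQ w wn; have [_ _ nV] := lcs_subgroup (freegroup X) n.
by rewrite (nccoef_magnusM_lcs _ n0 (nV _ ns) wn) (nccoef_magnusV_lcs n0 ns wn) rP ?sQ.
Qed.

Lemma leading_part_lie n r : (0 < n)%N -> lcs n r ->
  exists2 P, P \in lie n & leading_part n r P.
Proof.
case: n => // n _; elim: n r => [|n IH] r; first by move=> _; apply: leading_part1.
have [n1 nM nV] := lcs_subgroup (freegroup X) n.+2.
have part1 : leading_part n.+2 (1%g : freegroup X) 0.
  by move=> w wn; rewrite magnus1 nccoef1 -size_eq0 wn.
move=> nr; suff [] : lcs n.+2 r /\
  exists2 P, P \in lie n.+2 & leading_part n.+2 r P by [].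
move: nr => /(_ [set s | lcs n.+2 s /\
  exists2 P, P \in lie n.+2 & leading_part n.+2 s P]); apply.
  split=> [|s t [ns [P lP sP]] [nt [Q lQ tQ]]|s [ns [P lP sP]]].
  - by split=> //; exists 0; rewrite ?rpred0.
  - split; first exact: nM.
    have H : leading_part n.+2 (1 * t^-1)%g (0 - Q) by apply: leading_partB.
    rewrite mul1g in H; have := leading_partB _ ns (nV _ nt) sP H.
    rewrite invgK => {}H; exists (P - (0 - Q)); last exact: H.
    by rewrite rpredB // rpredB ?rpred0.
  - split; first exact: nV.
    have H : leading_part n.+2 (1 * s^-1)%g (0 - P) by apply: leading_partB.
    by rewrite mul1g in H; exists (0 - P); [rewrite rpredB ?rpred0|apply: H].
move=> _ [a [b [na _ ->]]]; split.
  by move=> H sH; apply; exists a, b.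
have [P lP aP] := IH a na; have [Q lQ bQ] := leading_part1 b.
exists (lie_bracket P Q); first by rewrite -addn1 lie_bracket_lie.
by apply: leading_part_commutator => //; apply: lie_homogeneous.
Qed.

Lemma lie_leading_part n P : (0 < n)%N -> P \in lie n ->
  exists2 r, lcs n r & leading_part n r P.
Proof.
move=> n0; have [n1 nM nV] := lcs_subgroup (freegroup X) n.
move: P; apply: zspan_ind => [|P Q [r nr rP] [s ns sQ]|_ [w wn ->]].
- by exists 1%g => // w wn; rewrite magnus1 nccoef1 -size_eq0 wn eqn0Ngt n0.
- by exists (r * s^-1)%g; [apply: nM => //; apply: nV|apply: leading_partB].
elim/last_ind: w n n0 wn {n1 nM nV} => [|w x IH] n n0 wn; first by rewrite -wn in n0.
have gen_x : leading_part 1 (fg_gen x) (ncX_fun x).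
  by move=> u u1; rewrite magnus_gen nccoefD nccoef1 -size_eq0 u1 add0r.
rewrite size_rcons in wn; have [w0|w0] := eqVneq w [::].
  by rewrite -wn w0; exists (fg_gen x).
have w1 : (0 < size w)%N by rewrite lt0n size_eq0.
have [r wr rP] := IH _ w1 erefl; exists [~ r, fg_gen x]%g.
  rewrite -wn; case: (size w) w1 wr => // k _ kr H sH; apply.
  by exists r, (fg_gen x).
rewrite left_bracket_rcons // -wn; apply: leading_part_commutator => //.
  exact: left_bracket_homogeneous.
exact: ncX_homogeneous.
Qed.

End LeadingParts.

(** * Relations between the Massey values *)

Section H2Classes.
Local Open Scope classical_set_scope.
Local Open Scope ring_scope.
Variable G : groupType.

Lemma cochain2MzE (c : cochain2 G) k p : (c *~ k) p = c p *~ k.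
Proof.
have natE m : (c *+ m) p = c p *+ m.
  by elim: m => [|m IH]; rewrite ?mulr0n // !mulrS -IH.
by case: k => m; rewrite ?NegzE ?mulrNz -!pmulrn -natE.
Qed.

Lemma cocycle2_val_sum (I : Type) (s : seq I) (z : I -> Z2 G) (a : I -> int) p :
  cocycle2_val (\sum_(i <- s) z i *~ a i) p = \sum_(i <- s) a i * cocycle2_val (z i) p.
Proof.
rewrite -[cocycle2_val _]/(val _) raddf_sum cochain2_sum; apply: eq_bigr => i _.
by rewrite raddfMz cochain2MzE -mulrzl intz.
Qed.

Lemma H2_class_sum_eq0 (I : Type) (s : seq I) (c : I -> cochain2 G)
    (cZ : forall i, c i \in @cocycles2 G) (a : I -> int) :
  \sum_(i <- s) H2_class (cZ i) *~ a i = 0 <->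
  exists b : cochain1 G, forall p, \sum_(i <- s) a i * c i p = diff1 b p.
Proof.
pose z i := Cocycle2 (cZ i).
have -> : \sum_(i <- s) H2_class (cZ i) *~ a i =
    (\pi_(Quotient.quot (@B2 G)) (\sum_(i <- s) z i *~ a i))%qT.
  rewrite [RHS]raddf_sum; apply: eq_bigr => i _.
  by rewrite [RHS]raddfMz.
rewrite -[0 : H2 G](raddf0 (\pi_(Quotient.quot (@B2 G)))%qT).
split.
  move=> /eqP; rewrite -Quotient.idealrBE subr0 => /asboolP[b zb].
  by exists b => p; rewrite -zb cocycle2_val_sum.
case=> b zb; apply/eqP; rewrite -Quotient.idealrBE subr0; apply/asboolP; exists b.
by apply/funext => p; rewrite -zb cocycle2_val_sum.
Qed.

End H2Classes.

Section MasseyRelations.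
Local Open Scope classical_set_scope.
Local Open Scope ring_scope.
Variables (X : choiceType) (n : nat).
Implicit Types (g h r : freegroup X).
Local Notation F := (freegroup X).
Local Notation pr := (Defs.proj (lcs_normal F n)).

(** The Massey value is, up to sign, the coboundary of the coefficient function of
    the whole word [w]; this function lives on the free group and need not factor
    through the quotient. *)
Lemma massey_value_proj (w : n.-tuple X) g h : (0 < n)%N ->
  @massey_value X n w (pr g, pr h) = (-1) ^+ n *
   (nccoef (magnus (g * h)%g) w - nccoef (magnus g) w - nccoef (magnus h) w).
Proof.
move=> n0; have ws : subword w 1 n.+1 = w.
  by rewrite /subword drop0 take_oversize ?size_tuple.
have := magnus_cut g h (size_tuple w) (isT : 0 < 1)%N (n0 : (1 < n.+1)%N) (leqnn _).
rewrite ws => ->; rewrite /massey_value cochain2_sum.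
rewrite [X in _ = _ * X](_ : _ = \sum_(2 <= k < n.+1) nccoef (magnus g) (subword w 1 k) *
  nccoef (magnus h) (subword w k n.+1)); last by ring.
rewrite mulr_sumr; apply: eq_big_nat => k /andP[k2 kn].
rewrite /cup !massey_cochain_proj ?size_tuple //; try (by case; lia); try lia.
rewrite mulrACA -exprD; congr (_ ^+ _ * _); lia.
Qed.

Lemma lcs_hom_eq0 (phi : F -> int) r : (1 < n)%N ->
  (forall g h, phi (g * h)%g = phi g + phi h) -> lcs n r -> phi r = 0.
Proof.
case: n => [|[|m]] // _ phiM.
have phi1 : phi 1%g = 0 by apply: (addrI (phi 1%g)); rewrite -phiM mulg1 addr0.
have phiV g : phi g^-1%g = - phi g.
  by apply/eqP; rewrite -addr_eq0 -phiM mulVg phi1.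
move=> /(_ [set g | phi g = 0]); apply.
  by split=> [|g h /= g0 h0|g /= g0]; rewrite //= ?phiM ?phiV ?g0 ?h0 ?addr0 ?oppr0.
move=> _ [a [b [_ _ ->]]] /=; rewrite commgEl conjgE !phiM !phiV; ring.
Qed.

(** On the free group the combination is, up to sign, the coboundary of
    [m = \sum_i a i * mu_(t i)]. If it is the coboundary of a cochain [c] of the
    quotient, then [c] composed with the projection differs from a multiple
    [(-1) ^+ n.+1] of [m] by a homomorphism. The homomorphism vanishes on [lcs n],
    and the composite is constant there, with the value 0 that it takes at 1; so
    [m] vanishes on [lcs n] as well. Conversely, if [m] vanishes on [lcs n], then
    it factors through the quotient. Finally, the values of [m] on [lcs n] are
    those of [\sum_i a i * P (t i)] for [P] in [lie n]. *)
Lemma psi_sum_eq0 (I : Type) (s : seq I) (t : I -> n.-tuple X) (a : I -> int) :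
  (1 < n)%N -> \sum_(i <- s) psi (t i) *~ a i = 0 <->
  forall P, P \in lie n -> \sum_(i <- s) a i * P (t i : seq X) = 0.
Proof.
move=> n1; have n0 : (0 < n)%N by apply: ltnW.
pose m g := \sum_(i <- s) a i * nccoef (magnus g) (t i).
have valE g h : \sum_(i <- s) a i * @massey_value X n (t i) (pr g, pr h) =
    (-1) ^+ n * (m (g * h)%g - m g - m h).
  rewrite /m -!sumrB mulr_sumr; apply: eq_bigr => i _.
  by rewrite massey_value_proj //; ring.
rewrite /psi H2_class_sum_eq0; split=> [[c cE] P lP|lie0].
  have [r rn rP] := lie_leading_part n0 lP.
  have mP : m r = \sum_(i <- s) a i * P (t i : seq X).
    by apply: eq_bigr => i _; rewrite rP ?size_tuple.
  have phiM g h : (-1) ^+ n * m (g * h)%g + c (pr (g * h)%g) =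
      ((-1) ^+ n * m g + c (pr g)) + ((-1) ^+ n * m h + c (pr h)).
    have := cE (pr g, pr h); rewrite valE /diff1 -projM => H.
    by apply/eqP; rewrite -subr_eq0; move/eqP: H; rewrite -subr_eq0 => /eqP <-; apply/eqP; ring.
  have m1 : m 1%g = 0.
    by rewrite /m big1 // => i _; rewrite magnus1 nccoef1 -size_eq0 size_tuple eqn0Ngt n0 mulr0.
  have phi0 g := lcs_hom_eq0 (r := g) n1 phiM.
  have pr1 : pr r = pr 1%g.
    by apply/proj_eq; have [_ nM nV] := lcs_subgroup F n; rewrite mulg1; apply: nV.
  have := phi0 r rn; rewrite pr1; have := phi0 1%g (let: And3 n1 _ _ := lcs_subgroup F n in n1).
  rewrite m1 mulr0 add0r => ->; rewrite addr0 mP => /eqP.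
  by rewrite mulf_eq0 signr_eq0 => /eqP.
have m_lcs g r : lcs n r -> m (g * r)%g = m g.
  move=> rn; have [P lP rP] := leading_part_lie n0 rn.
  transitivity (m g + m r).
    rewrite /m -big_split; apply: eq_bigr => i _.
    by rewrite (nccoef_magnusM_lcs _ n0 rn (size_tuple (t i))) mulrDr.
  rewrite -[RHS]addr0; congr (_ + _); rewrite -(lie0 P lP).
  by apply: eq_bigr => i _; rewrite rP ?size_tuple.
have mE g : m (repr (pr g)) = m g.
  rewrite -[in RHS](mulVKg (repr (pr g)) g) m_lcs //.
  by have /proj_eq := reprP (pr g).
exists (fun q => - ((-1) ^+ n * m (repr q))) => -[p q].
rewrite -[p]reprP -[q]reprP valE /diff1 -projM !mE; ring.
Qed.

End MasseyRelations.

(** * The basis given by Lyndon words *)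

Section Unitriangular.
Local Open Scope classical_set_scope.
Local Open Scope ring_scope.
Variables (T : eqType) (M : T -> T -> int).
Implicit Types (s : seq T) (i j : T) (a g : T -> int).

Fixpoint unitriangular s : Prop :=
  if s is i :: s' then
    [/\ M i i = 1, forall j, j \in s' -> M j i = 0 & unitriangular s']
  else True.

Lemma unitriangular_inj s a : unitriangular s ->
  (forall i, i \in s -> \sum_(j <- s) a j * M i j = 0) ->
  forall j, j \in s -> a j = 0.
Proof.
elim: s => //= i s IH [Mii Mi us] H.
have as0 j : j \in s -> a j = 0.
  apply: IH => // k ks; have := H k; rewrite inE ks orbT => /(_ isT).
  by rewrite big_cons Mi // mulr0 add0r.
have := H i (mem_head _ _); rewrite big_cons Mii mulr1 big_seq big1 ?addr0 => [ai|j js].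
  by move=> j; rewrite inE => /orP[/eqP ->|/as0].
by rewrite as0 // mul0r.
Qed.

Lemma unitriangular_solve s g : uniq s -> unitriangular s ->
  exists a, forall i, i \in s -> \sum_(j <- s) a j * M i j = g i.
Proof.
elim: s => [|i s IH] /=; first by exists (fun=> 0).
move=> /andP[is_ us] [Mii Mi /(IH us)[a aP]].
pose ai := g i - \sum_(j <- s) a j * M i j.
exists (fun j => if j == i then ai else a j) => k.
have E : \sum_(j <- s) (if j == i then ai else a j) * M k j = \sum_(j <- s) a j * M k j.
  by apply: eq_big_seq => j js; case: eqP => // ji; rewrite -ji js in is_.
rewrite big_cons eqxx E inE => /orP[/eqP ->|ks]; first by rewrite Mii mulr1 subrK.
by rewrite Mi // mulr0 add0r aP.
Qed.

End Unitriangular.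

Section Basis.
Local Open Scope classical_set_scope.
Local Open Scope ring_scope.
Variables (V : zmodType) (B : choiceType) (b : B -> V).
Local Open Scope fset_scope.

Lemma sum_finsupp (c : {fsfun B -> int with 0}) (A : {fset B}) : finsupp c `<=` A ->
  \sum_(i <- finsupp c) b i *~ c i = \sum_(i <- A) b i *~ c i.
Proof.
by move=> cA; apply: big_fset_incl => // i _ ic; rewrite fsfun_dflt // mulr0z.
Qed.

Lemma is_basis_of : (forall v, v \in zspan (range b)) ->
  (forall (s : seq B) (a : B -> int), uniq s ->
    \sum_(i <- s) b i *~ a i = 0 -> forall i, i \in s -> a i = 0) ->
  is_basis b.
Proof.
move=> gen indep v.
have [c ->] : exists c : {fsfun B -> int with 0}, v = \sum_(i <- finsupp c) b i *~ c i.
  move: v (gen v); apply: zspan_ind => [|u w [c ->] [c' ->]|_ [i _ <-]].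
  - by exists [fsfun]; rewrite finsupp0 big_seq_fset0.
  - pose A := finsupp c `|` finsupp c'.
    pose e : {fsfun B -> int with 0} := [fsfun i in A => c i - c' i].
    have eE i : e i = c i - c' i.
      rewrite fsfun_fun; case: ifP => // /negbT.
      by rewrite inE negb_or => /andP[ic ic']; rewrite !fsfun_dflt ?subr0.
    have eA : finsupp e `<=` A by apply: finsupp_sub.
    exists e; rewrite (sum_finsupp eA) (@sum_finsupp c A) ?fsubsetUl //.
    rewrite (@sum_finsupp c' A) ?fsubsetUr // -sumrB.
    by apply: eq_bigr => i _; rewrite eE mulrzBr.
  - pose e : {fsfun B -> int with 0} := [fsfun j in [fset i] => 1].
    have eA : finsupp e `<=` [fset i] by apply: finsupp_sub.
    exists e; rewrite (sum_finsupp eA) big_seq_fset1.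
    by rewrite fsfun_fun inE eqxx mulr1z.
exists c; split=> // c' cc'; apply/fsfunP => i.
pose A := finsupp c `|` finsupp c'.
have /indep := fset_uniq A => /(_ (fun i => c i - c' i)) H.
have {}H j : j \in A -> c j - c' j = 0.
  apply: H; move: cc'; rewrite (@sum_finsupp c A) ?fsubsetUl //.
  rewrite (@sum_finsupp c' A) ?fsubsetUr // => /eqP; rewrite -subr_eq0 -sumrB => /eqP cc'0.
  by rewrite -[RHS]cc'0; apply: eq_bigr => k _; rewrite mulrzBr.
have [/H/eqP|] := boolP (i \in A); first by rewrite subr_eq0 => /eqP.
by rewrite inE negb_or => /andP[ic ic']; rewrite !fsfun_dflt.
Qed.

End Basis.

Section MasseyBasis.
Local Open Scope classical_set_scope.
Local Open Scope ring_scope.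
Variables (d : Order.disp_t) (X : orderType d) (n : nat).
Hypothesis n2 : (1 < n)%N.

Local Notation lyndon_tuple := {w : n.-tuple X | lyndon w}.

Implicit Types (i j : lyndon_tuple) (u : n.-tuple X).
Local Notation word i := (val (val (i : lyndon_tuple)) : seq X).

Definition lyndon_pairing i j : int := lyndon_poly (word i) (word j).

Lemma sorted_unitriangular (s : seq lyndon_tuple) : uniq s ->
  sorted (fun i j => word i <= word j)%O s -> unitriangular lyndon_pairing s.
Proof.
elim: s => //= i s IH /andP[is_ us] ps; split.
- by have [] := lyndon_poly_triangular (valP i).
- move=> j js; apply/eqP/negPn/negP => ij.
  have [_ /(_ _ ij)[_ ji]] := lyndon_poly_triangular (valP j).
  have tr : transitive (fun i j => word i <= word j)%O by move=> ? ? ?; apply: le_trans.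
  have := order_path_min tr ps => /allP /(_ j js) ij'.
  have ijE : i = j by apply/val_inj/val_inj/le_anti; rewrite ij' ji.
  by rewrite ijE js in is_.
- exact: IH us (path_sorted ps).
Qed.

Lemma sort_unitriangular (s : seq lyndon_tuple) : uniq s ->
  exists2 s', perm_eq s' s & unitriangular lyndon_pairing s'.
Proof.
move=> us; exists (sort (fun i j => word i <= word j)%O s); first by rewrite perm_sort.
apply: sorted_unitriangular; first by rewrite sort_uniq.
by apply: sort_sorted => i j; apply: le_total.
Qed.

Lemma psi_lyndon_indep (s : seq lyndon_tuple) (a : lyndon_tuple -> int) : uniq s ->
  \sum_(i <- s) psi (val i) *~ a i = 0 -> forall i, i \in s -> a i = 0.
Proof.
move=> us /psi_sum_eq0 H i; have [s' ss' us'] := sort_unitriangular us.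
rewrite -(perm_mem ss'); apply: (unitriangular_inj us') => j _.
rewrite (perm_big _ ss') /=; apply: H => //.
by have := lyndon_poly_lie (valP j); rewrite size_tuple.
Qed.

(** The functional to be matched is the coefficient at [u] on the polynomials
    [lyndon_poly w]. When [w] is not a rearrangement of [u], it vanishes, and so
    do the coefficients at the rearrangements of [u]; this leaves a finite
    unitriangular system. *)
Lemma psi_lyndon_gen u : exists (s : seq lyndon_tuple) (a : lyndon_tuple -> int),
  psi u = \sum_(i <- s) psi (val i) *~ a i.
Proof.
have [s su us] : exists2 s : seq lyndon_tuple,
    (forall i, (i \in s) = perm_eq (word i) u) & uniq s.
  pose s0 : seq (n.-tuple X) := pmap insub (permutations u).
  exists (pmap insub s0); last by rewrite !pmap_sub_uniq // permutations_uniq.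
  by move=> i; rewrite mem_pmap_sub mem_pmap_sub mem_permutations.
have [s' ss' us'] := sort_unitriangular us.
have us'' : uniq s' by rewrite (perm_uniq ss').
have [a aP] := unitriangular_solve (fun i => lyndon_poly (word i) u) us'' us'.
exists s', a; apply/eqP; rewrite eq_sym -subr_eq0; apply/eqP.
(* the index [None] stands for the word [u], moved to the other side *)
pose t (o : option lyndon_tuple) := if o is Some i then val i else u.
pose a' o := if o is Some i then a i else -1.
have := @psi_sum_eq0 X n _ (None :: map Some s') t a' n2.
rewrite big_cons big_map /= mulrN1z addrC => ->.
move=> P /lie_lyndon_span; move: P; apply: zspan_ind.
- by rewrite big1 // => o _; rewrite mulr0.
- move=> P Q P0 Q0; rewrite -[RHS](subrr 0) -[X in _ = X - _]P0 -[X in _ = _ - X]Q0 -sumrB.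
  by apply: eq_bigr => o _; rewrite wordfunB mulrBr.
move=> _ [w [lw wn _ ->]]; have [_ wtri] := lyndon_poly_triangular lw.
rewrite big_cons big_map /= mulN1r.
have wn' : size w == n by rewrite wn.
pose i : lyndon_tuple := exist _ (Tuple wn') lw.
have [ius|wu] := boolP (i \in s').
  by have := aP i ius; rewrite /lyndon_pairing /= => <-; rewrite addNr.
have {}wu : ~~ perm_eq w u by move: wu; rewrite (perm_mem ss') su.
rewrite (_ : lyndon_poly w u = 0) ?oppr0 ?add0r; last first.
  by apply/eqP/negPn/negP => /wtri[]; rewrite perm_sym (negbTE wu).
rewrite big_seq big1 // => j; rewrite (perm_mem ss') su => ju.
rewrite (_ : lyndon_poly w _ = 0) ?mulr0 //; apply/eqP/negPn/negP => /wtri[jw _].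
by rewrite perm_sym in jw; rewrite (perm_trans jw ju) in wu.
Qed.

Lemma psi_in_span u : psi u \in zspan (range (@psi X n)).
Proof. by apply: mem_zspan; exists u. Qed.

Definition massey_basis i : H2_massey X n := SpanOf (psi_in_span (val i)).

Lemma span_val_massey_sum (s : seq lyndon_tuple) (a : lyndon_tuple -> int) :
  span_val (\sum_(i <- s) massey_basis i *~ a i) = \sum_(i <- s) psi (val i) *~ a i.
Proof.
rewrite -[span_val _]/(val _) raddf_sum; apply: eq_bigr => i _.
by rewrite raddfMz.
Qed.

Lemma massey_basisP : is_basis massey_basis.
Proof.
apply: is_basis_of => [[x Sx]|s a us sa0]; last first.
  by apply: psi_lyndon_indep => //; rewrite -span_val_massey_sum sa0.
have [v vB vx] : exists2 v, v \in zspan (range massey_basis) & span_val v = x.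
  move: x {Sx} (Sx); apply: zspan_ind => [|_ _ [v vB <-] [w wB <-]|_ [u _ <-]].
  - by exists 0; first exact: rpred0.
  - by exists (v - w); first exact: rpredB.
  have [s [a ->]] := psi_lyndon_gen u.
  exists (\sum_(i <- s) massey_basis i *~ a i); last exact: span_val_massey_sum.
  by apply: rpred_sum => i _; apply: rpredMz; apply: mem_zspan; exists i.
by rewrite (_ : SpanOf Sx = v) //; apply: val_inj.
Qed.

End MasseyBasis.

(** * The rank *)

Section Rank.
Local Open Scope classical_set_scope.
Local Open Scope ring_scope.
Variables (d : Order.disp_t) (X : orderType d) (n : nat).
Local Notation lyndon_tuple := {w : n.-tuple X | lyndon w}.
Local Notation word i := (val (val (i : lyndon_tuple)) : seq X).

Lemma cardinal_seq (T : choiceType) (s : seq T) : uniq s -> (forall x, x \in s) ->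
  cardinal T = Some (size s).
Proof.
move=> us sT; have Ts : [set: T] = [set` s] by apply/seteqP; split=> x _ //=; apply: sT.
have fT : finite_set [set: T] by rewrite Ts.
rewrite /cardinal asboolT //; congr Some; apply: perm_size.
apply: uniq_perm; rewrite ?fset_uniq // => x.
by rewrite in_fset_set // sT; apply/mem_set.
Qed.

Lemma cardinal_infinite (T : choiceType) : ~ finite_set [set: T] -> cardinal T = None.
Proof. by move=> infT; rewrite /cardinal asboolF. Qed.

Lemma lyndon_two_letters k (x y : X) : (x < y)%O -> lyndon (rcons (nseq k x) y).
Proof.
move=> xy; elim: k => [|k IH] //=; apply: (@lyndon_cat _ _ [:: x]) => //.
case: k {IH} => [|k] /=; first by rewrite ltxi_cons (ltW xy) leNgt xy.
by apply: (@ltxi_catl _ _ [:: x]); case: k.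
Qed.

(** With two letters at least, every letter occurs in a Lyndon word of length [n],
    of the form [x..xy] with [x < y]; so finitely many Lyndon words would involve
    finitely many letters. *)
Lemma lyndon_infinite : (1 < n)%N -> ~ finite_set [set: X] ->
  ~ finite_set [set: lyndon_tuple].
Proof.
move=> n2 infX finL; apply: (infX).
apply: (@sub_finite_set _ _ (\bigcup_(i in [set: lyndon_tuple]) [set` word i])).
  move=> x _; have [y yx] : exists y, y != x.
    apply: contrapT => /forallNP H; apply: infX.
    by apply: (@sub_finite_set _ _ [set x]) => // y _; apply/eqP/negPn/negP/H.
  have lohi : (Order.min x y < Order.max x y)%O.
    by have [xy|xy|xy] := ltgtP x y; rewrite // xy eqxx in yx.
  have sw : size (rcons (nseq n.-1 (Order.min x y)) (Order.max x y)) == n.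
    by rewrite size_rcons size_nseq prednK // ltnW.
  exists (exist (fun w : n.-tuple X => lyndon w) (Tuple sw) (lyndon_two_letters n.-1 lohi)) => //=.
  rewrite mem_rcons inE mem_nseq -subn1 subn_gt0 n2 /=.
  by have [xy|xy|xy] := ltgtP x y; rewrite ?eqxx ?orbT.
by apply: bigcup_finite.
Qed.

Lemma cardinal_lyndon : (0 < n)%N -> finite_set [set: X] ->
  omap (fun k => k%:R) (cardinal lyndon_tuple) = necklace (cardinal X) n :> option rat.
Proof.
move=> n0 finX; pose E : seq X := fset_set [set: X].
have uE : uniq E by apply: fset_uniq.
have EX x : x \in E by rewrite in_fset_set //; apply/mem_set.
pose s0 : seq (n.-tuple X) := pmap insub (words E n).
rewrite (cardinal_seq uE EX) necklace_count_lyndon //.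
have us0 : uniq s0 by rewrite pmap_sub_uniq // words_uniq.
have s0X w : w \in s0.
  by rewrite mem_pmap_sub mem_words size_tuple eqxx; apply/allP => x _; apply: EX.
rewrite (@cardinal_seq lyndon_tuple (pmap insub s0)).
- rewrite /= size_pmap_sub -(count_map val (@lyndon _ X)) pmap_filter; last exact: insubK.
  rewrite count_filter; congr (Some _%:R); apply: eq_in_count => w.
  by rewrite mem_words /= isSome_insub => /andP[-> _]; rewrite andbT.
- by rewrite pmap_sub_uniq.
- by move=> i; rewrite mem_pmap_sub.
Qed.

End Rank.

(** * Ordering the letters *)

Section OrderChoice.
Local Open Scope classical_set_scope.
Local Open Scope ring_scope.
Variable X : choiceType.

(** Lyndon words require a total order of the letters, and any order will do; the
    well-ordering principle provides one. *)
Definition well_ordered : Type := X.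

HB.instance Definition _ := Choice.on well_ordered.

Definition wo_le : rel well_ordered := sval (well_ordering_principle X).

Lemma wo_leP : well_order wo_le.
Proof. exact: (svalP (well_ordering_principle X)). Qed.

Lemma wo_le_total : total wo_le.
Proof.
move=> x y; have [|m [[]]] := wo_leP (A := [in [:: x; y]]).
  by exists x; rewrite !inE eqxx.
rewrite !inE => /orP[]/eqP -> le_m _; apply/orP; [left|right];
  by apply: le_m; rewrite !inE eqxx ?orbT.
Qed.

Lemma wo_le_refl : reflexive wo_le.
Proof. by move=> x; have := wo_le_total x x; rewrite orbb. Qed.

Lemma wo_le_anti : antisymmetric wo_le.
Proof.
move=> x y /andP[xy yx]; have [|m [_ m_uniq]] := wo_leP (A := [in [:: x; y]]).
  by exists x; rewrite !inE eqxx.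
rewrite -(m_uniq x) ?(m_uniq y) //; split; rewrite ?inE ?eqxx ?orbT // => z;
  by rewrite !inE => /orP[]/eqP ->; rewrite ?wo_le_refl.
Qed.

Lemma wo_le_trans : transitive wo_le.
Proof.
move=> y x z xy yz; have [|m [[]]] := wo_leP (A := [in [:: x; y; z]]).
  by exists x; rewrite !inE eqxx.
rewrite !inE => m_in le_m _.
have mx : wo_le m x by apply: le_m; rewrite !inE eqxx.
have my : wo_le m y by apply: le_m; rewrite !inE eqxx orbT.
have mz : wo_le m z by apply: le_m; rewrite !inE eqxx !orbT.
case/or3P: m_in => /eqP mE; rewrite mE in mx my mz; first exact: mz.
  by rewrite (@wo_le_anti x y) ?xy.
by rewrite -(@wo_le_anti y z) ?yz.
Qed.

Fact wo_display : Order.disp_t. Proof. exact: Order.Disp tt tt. Qed.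

HB.instance Definition _ := Order.Le_isPOrder.Build wo_display well_ordered
  wo_le_refl wo_le_anti wo_le_trans.
HB.instance Definition _ :=
  Order.POrder_isTotal.Build wo_display well_ordered wo_le_total.

End OrderChoice.

Lemma massey_free_of_rank (d : Order.disp_t) (X : orderType d) n : (1 < n)%N ->
  free_of_rank (H2_massey X n) (necklace (cardinal X) n).
Proof.
move=> n2; exists {w : n.-tuple X | lyndon w}, (@massey_basis d X n).
split; first exact: massey_basisP.
have [finX|infX] := pselect (finite_set [set: X]).
  by apply: cardinal_lyndon => //; apply: ltnW.
by rewrite !cardinal_infinite //; apply: lyndon_infinite.
Qed.

Theorem corollary9p4 (X : choiceType) (n : nat) (hn : 2 <= n) :
  free_of_rank (H2_massey X n) (necklace (cardinal X) n).
Proof.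
(* an explicit structure on the letters makes the choice type underlying their
   ordered copy convertible to the given one *)
case: X => T cT.
exact: (massey_free_of_rank (well_ordered (Choice.Pack cT)) hn).
Qed.
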